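(* Let $n\in\mathbb{N}$, $n\ge 1$, and $\alpha,\beta,\gamma>-1$. Then for every $j=1,\dots,2n$ the zero $x_{n,j}(\alpha,\beta+1,\gamma;a)$ of the polynomial $P_n^{(\alpha,\beta+1,\gamma)}(x;a)$ is an increasing function of $a\in(-\infty,0)$.
   Context: Angelesco-Jacobi polynomials: for $a<0$, $\alpha,\beta,\gamma>-1$ and $n\in\mathbb{N}\cup\{0\}$, $P_n^{(\alpha,\beta,\gamma)}(x;a)$ denotes the unique monic polynomial in $x$ of degree $2n$ such that for $k=0,1,\dots,n-1$, $$\int_a^0 x^k P_n^{(\alpha,\beta,\gamma)}(x;a)(1-x)^\alpha(x-a)^\beta|x|^\gamma\,dx=0,\qquad \int_0^1 x^k P_n^{(\alpha,\beta,\gamma)}(x;a)(1-x)^\alpha(x-a)^\beta x^\gamma\,dx=0.$$ All its zeros are real and simple; they are denoted in increasing order by $x_{n,1}(\alpha,\beta,\gamma;a)<\cdots<x_{n,2n}(\alpha,\beta,\gamma;a)$. Exactly $n$ of them lie in $(a,0)$ and exactly $n$ lie in $(0,1)$. *)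

(* Defs.v *)
From HB Require Import structures.
From mathcomp Require Import all_boot all_order all_algebra.
From mathcomp Require Import all_classical all_reals all_analysis.
From mathcomp Require Import polyrcf.

Set Implicit Arguments.
Unset Strict Implicit.
Unset Printing Implicit Defensive.

Import Order.TTheory GRing.Theory Num.Theory.
Import numFieldNormedType.Exports.

Local Open Scope classical_set_scope.
Local Open Scope ring_scope.

(* The integrals are extended-real valued Lebesgue integrals over the open
   intervals: the integrand is absolutely integrable there when a < 0 and
   alpha, beta, gamma > -1, but may blow up at the endpoints. The open
   intervals also avoid the conventional values of [powR] at base 0. *)
Definition is_angelesco_jacobi (R : realType) (n : nat)
    (alpha beta gamma a : R) (p : {poly R}) : Prop :=
  [/\ p \is monic,
      size p = n.*2.+1 &
      forall k : nat, (k < n)%N ->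
        (\int[lebesgue_measure]_(x in `]a, 0%R[)
           (x ^+ k * p.[x] * (1 - x) `^ alpha * (x - a) `^ beta
              * `|x| `^ gamma)%:E = 0)%E /\
        (\int[lebesgue_measure]_(x in `]0%R, 1%R[)
           (x ^+ k * p.[x] * (1 - x) `^ alpha * (x - a) `^ beta
              * x `^ gamma)%:E = 0)%E].

(* The default value 0 is never used in the range of parameters where the
   polynomial exists. *)
Definition angelesco_jacobi (R : realType) (n : nat)
    (alpha beta gamma a : R) : {poly R} :=
  xget 0 [set p | is_angelesco_jacobi n alpha beta gamma a p].

(* [rootsR p] lists the distinct real roots of [p] in increasing order; the
   index j is 1-based, 1 <= j <= 2n. *)
Definition angelesco_jacobi_zero (R : realType) (n : nat)
    (alpha beta gamma a : R) (j : nat) : R :=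
  (rootsR (angelesco_jacobi n alpha beta gamma a))`_j.-1.

(* Main.v *)
Require Import Defs.
From mathcomp Require Import all_boot all_order all_algebra.
From mathcomp Require Import all_classical all_reals all_analysis.
From mathcomp Require Import measurable_realfun polyorder polyrcf ring lra.

Set Implicit Arguments.
Unset Strict Implicit.
Unset Printing Implicit Defensive.

Import Order.TTheory GRing.Theory Num.Theory.
Import numFieldNormedType.Exports.

Local Open Scope classical_set_scope.
Local Open Scope ring_scope.

(* Put [B = beta + 1] and let [P] and [Q] be the polynomials for the exponents [B]
   and [beta] of [x - a]; the weight of [P] is [x - a] times that of [Q].
   Differentiating the orthogonality relations of [P] in [a] shows that
   [(x - a) dP/da = B (P - c Q)] with [c = P(a) / Q(a) > 0], so a zero [x] of [P]
   moves with speed [B c Q(x) / ((x - a) P'(x))]. This is positive by interlacing: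
   no combination [A P + B Q] has a double real zero, because dividing such a zero
   out leaves a polynomial with [n - 1] zeros in each interval, and the next
   moments of [Q] on the two intervals force incompatible signs on it; hence the
   Wronskian [P' Q - P Q'] never vanishes, and its leading coefficient is positive.
   As [(x - a)^B] is singular at [a], only the right derivative in [a] is computed:
   it gives [x_j(b) > x_j(a)] for [b > a] close to [a], and continuity of the zeros
   makes this global, the maximum over [[a, b]] being attained at [b] only. *)

(** * Polynomials orthogonal for functionals positive on an interval *)

(** Why P - c Q appears: the derivative of (x - a)^B in [a] is -B (x - a)^beta, and B > 0 leaves no
    boundary term. Differentiating the vanishing moments of P therefore makes (x - a) dP/da - B P
    orthogonal to x^k, k < n, for the weight of Q on both intervals. It has degree at most 2n, so it
    is a multiple of Q, and its value at [a] fixes the multiple. Finally c > 0 because P and Q both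
    have an even number 2n of zeros, all to the right of [a].

    The sign of the Wronskian is less direct: its formal leading terms cancel, and the next
    coefficient is minus the coefficient of x^(2n-1) in P - Q, whose sign again comes from the next
    moments of Q.

    All this algebra only needs linear, strictly positive functionals, so it is done for abstract
    ones over a real closed field. The analysis is reduced to limits of 2n moments, since the
    invertible moment matrix recovers a polynomial from them. The zeros themselves are never
    differentiated: sign changes of P at the old zeros locate the new ones. *)

Section positive_functionals.
Variable R : rcfType.
Implicit Types (p q f g : {poly R}) (s : seq R) (I : interval R).

Definition rprod s : {poly R} := \prod_(x <- s) ('X - x%:P).

Lemma rprod_monic s : rprod s \is monic.
Proof. exact: monic_prod_XsubC. Qed.

Lemma size_rprod s : size (rprod s) = (size s).+1.
Proof. exact: size_prod_XsubC. Qed.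

Lemma rprod_gt0 s (x : R) : {in s, forall y, y < x} -> 0 < (rprod s).[x].
Proof.
move=> sx; rewrite /rprod horner_prod big_seq; apply: prodr_gt0 => y /sx yx.
by rewrite hornerXsubC subr_gt0.
Qed.

Lemma rprod_lt s (x : R) :
  {in s, forall y, x < y} -> 0 < (-1) ^+ size s * (rprod s).[x].
Proof.
elim: s => [|y s ih] sx; first by rewrite /rprod big_nil hornerC mulr1 expr0.
rewrite /rprod big_cons hornerM hornerXsubC exprS mulrACA mulN1r opprB.
by rewrite mulr_gt0 ?subr_gt0 ?sx ?mem_head// ih// => z zs; rewrite sx// in_cons zs orbT.
Qed.

(** By induction on the degree, [s] collects the roots in [I] of odd multiplicity, so that the
    product with [rprod s] has only even multiplicities there. The last clause expresses constant
    sign without deciding which one. *)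
Lemma odd_roots I f : f != 0 ->
  exists s, [/\ uniq s, {in s, forall x, x \in I}, rprod s %| f
    & {in I &, forall x y, 0 <= (f * rprod s).[x] * (f * rprod s).[y]}].
Proof.
have [m] := ubnP (size f); elim: m f => // m ih f; rewrite ltnS => szf f0.
have [[y yI fy]|nor] := pselect (exists2 y, y \in I & root f y); last first.
  exists [::]; rewrite /rprod big_nil mulr1 dvd1p; split=> // x y xI yI.
  rewrite leNgt; apply/negP => fxy.
  wlog xy : x y xI yI fxy / x <= y.
    by move=> h; case: (leP x y) => [/h|/ltW/h]; apply => //; rewrite mulrC.
  have [z zxy fz] := poly_ivtoo xy fxy; apply: nor; exists z => //.
  by apply: (subitvP _ zxy); exact: sub_oo_itv.
have /factor_theorem[g fE] := fy.
have g0 : g != 0 by apply: contraNneq f0 => g0; rewrite fE g0 mul0r.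
have /ih/(_ g0) : (size g < m)%N.
  by apply: leq_trans szf; rewrite fE size_Mmonic ?monicXsubC// size_XsubC addn2.
move=> [s [us sI sg sgn]].
(* One more factor at [y] flips the parity of its multiplicity, so [y] leaves or enters the list. *)
have [ys|ys] := boolP (y \in s).
  exists (rem y s); have E : rprod s = ('X - y%:P) * rprod (rem y s).
    by rewrite /rprod (big_rem y).
  split; first exact: rem_uniq.
  - by move=> x /mem_rem/sI.
  - by rewrite fE dvdp_mulr// (dvdp_trans _ sg)// E dvdp_mulIr.
  - by rewrite fE -mulrA -E.
exists (y :: s); have E : rprod (y :: s) = ('X - y%:P) * rprod s.
  by rewrite /rprod big_cons.
split=> /=; first by rewrite ys.
- by move=> x; rewrite in_cons => /predU1P[->|/sI].
- by rewrite fE E mulrC dvdp_mul.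
- have -> : f * rprod (y :: s) = ('X - y%:P) ^+ 2 * (g * rprod s).
    by rewrite fE E; ring.
  move=> x z xI zI; rewrite !(hornerM (_ ^+ 2)) !horner_exp mulrACA.
  by rewrite mulr_ge0 ?sgn// mulr_ge0 ?sqr_ge0.
Qed.

Lemma size_monicB k p q : p \is monic -> q \is monic ->
  size p = k.+1 -> size q = k.+1 -> (size (p - q)%R <= k)%N.
Proof.
move=> pm qm sp sq; apply/leq_sizeP => j; rewrite leq_eqVlt coefB.
move=> /predU1P[<-|kj]; last by rewrite !nth_default ?sp ?sq// subrr.
by rewrite -[k]/(k.+1.-1) -{1}sp -sq -!lead_coefE !(monicP _)// subrr.
Qed.

Definition linear_functional (L : {poly R} -> R) :=
  forall c p q, L (c *: p + q) = c * L p + L q.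

Lemma linear_functional0 L : linear_functional L -> L 0 = 0.
Proof.
move=> lL; have := lL 1 0 0; rewrite scaler0 addr0 mul1r => /eqP.
by rewrite -subr_eq0 opprD addNKr oppr_eq0 => /eqP.
Qed.

Lemma linear_functionalZ L c p : linear_functional L -> L (c *: p) = c * L p.
Proof. by move=> lL; rewrite -[c *: p]addr0 lL linear_functional0 ?addr0. Qed.

Lemma linear_functionalB L p q : linear_functional L -> L (p - q) = L p - L q.
Proof. by move=> lL; rewrite addrC -scaleN1r lL mulN1r addrC. Qed.

(** Abstracts integration against a positive weight on [I]; the strict inequality reflects that a
    nonzero polynomial has only finitely many zeros. *)
Record posfun I (L : {poly R} -> R) : Prop := PosFun {
  posfun_lin : linear_functional L;
  posfun_gt0 : forall p, p != 0 -> {in I, forall x, 0 <= p.[x]} -> 0 < L p }.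

Definition orth (L : {poly R} -> R) m f :=
  forall r : {poly R}, (size r <= m)%N -> L (f * r) = 0.

Section posfun_theory.
Variables (I : interval R) (L : {poly R} -> R).
Hypothesis HL : posfun I L.

Lemma posfun0 : L 0 = 0.
Proof. exact: linear_functional0 (posfun_lin HL). Qed.

Lemma posfunZ c p : L (c *: p) = c * L p.
Proof. exact: linear_functionalZ (posfun_lin HL). Qed.

Lemma posfunB p q : L (p - q) = L p - L q.
Proof. exact: linear_functionalB (posfun_lin HL). Qed.

Lemma posfunN p : L (- p) = - L p.
Proof. by rewrite -sub0r posfunB posfun0 sub0r. Qed.

Lemma posfun_weight h : h != 0 -> {in I, forall x, 0 <= h.[x]} ->
  posfun I (fun p => L (h * p)).
Proof.
move=> h0 hI; split=> [c p q|p p0 pI].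
  by rewrite mulrDr -scalerAr (posfun_lin HL).
apply: (posfun_gt0 HL); first by rewrite mulf_neq0.
by move=> x xI; rewrite hornerM mulr_ge0 ?hI ?pI.
Qed.

(* With fewer sign changes in [I], testing against the product over them would
   give an integrand of constant sign. *)
Lemma orth_roots m f : f != 0 -> orth L m f ->
  exists s, [/\ size s = m, uniq s, {in s, forall x, x \in I} & all (root f) s].
Proof.
move=> f0 Lf; have [s [us sI sf sgn]] := odd_roots I f0.
have sroot : all (root f) s.
  apply/allP => x xs; apply: (root_dvdp sf).
  by rewrite root_prod_XsubC.
have f1 : f * rprod s != 0 by rewrite mulf_neq0// monic_neq0// rprod_monic.
have ms : (m <= size s)%N.
  rewrite leqNgt; apply/negP => sm.
  have L0 : L (f * rprod s) = 0 by apply: Lf; rewrite size_rprod.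
  have [[x xI fx]|nox] := pselect (exists2 x, x \in I & (f * rprod s).[x] < 0).
    have := posfun_gt0 HL (p := - (f * rprod s)).
    rewrite oppr_eq0 posfunN L0 oppr0 ltxx => /(_ f1) H.
    suff: false by []; apply: H => y yI; rewrite hornerN oppr_ge0.
    by rewrite -(nmulr_rge0 _ fx) sgn.
  have := posfun_gt0 HL f1; rewrite L0 ltxx => H.
  suff: false by []; apply: H => y yI; rewrite leNgt; apply/negP => fy.
  by apply: nox; exists y.
exists (take m s); split; rewrite ?take_uniq//.
- by rewrite size_takel.
- by move=> x /mem_take/sI.
- by apply/allP => x /mem_take xs; exact: (allP sroot).
Qed.

(** The two tests differ by a polynomial of degree below [m]. Hence the next moment may be computed
    with whichever monic test makes its sign visible. *)
Lemma orth_monic m f (r r' : {poly R}) : orth L m f -> r \is monic -> r' \is monic ->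
  size r = m.+1 -> size r' = m.+1 -> L (f * r) = L (f * r').
Proof.
move=> Lf rm rm' sr sr'; apply/eqP; rewrite -subr_eq0 -posfunB -mulrBr Lf//.
exact: size_monicB.
Qed.

End posfun_theory.

Lemma orth_root_dvdp (a c b : R) L1 L2 m f :
  posfun `]a, c[ L1 -> posfun `]c, b[ L2 -> f != 0 ->
  orth L1 m f -> orth L2 m f ->
  exists s1 s2, [/\ size s1 = m /\ size s2 = m,
    {in s1, forall x, x \in `]a, c[}, {in s2, forall x, x \in `]c, b[},
    uniq (s1 ++ s2) & rprod s1 * rprod s2 %| f].
Proof.
move=> HL1 HL2 f0 o1 o2.
have [s1 [z1 u1 i1 r1]] := orth_roots HL1 f0 o1.
have [s2 [z2 u2 i2 r2]] := orth_roots HL2 f0 o2.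
have u : uniq (s1 ++ s2).
  rewrite cat_uniq u1 u2 andbT; apply/hasPn => x /i2.
  rewrite in_itv/= => /andP[cx _]; apply/negP => /i1.
  by rewrite in_itv/= => /andP[_ /(lt_trans cx)]; rewrite ltxx.
exists s1, s2; split=> //.
rewrite /rprod -big_cat; apply: uniq_roots_dvdp; last by rewrite uniq_rootsE.
by rewrite all_cat r1 r2.
Qed.

(** A nonzero [f] would have 2m distinct zeros, more than its degree allows. *)
Lemma orth_eq0 (a c b : R) L1 L2 m f :
  posfun `]a, c[ L1 -> posfun `]c, b[ L2 ->
  orth L1 m f -> orth L2 m f -> (size f <= m.*2)%N -> f = 0.
Proof.
move=> HL1 HL2 o1 o2 sf; apply/eqP/negPn/negP => f0.
have [s1 [s2 [[z1 z2] _ _ _ /dvdp_leq]]] := orth_root_dvdp HL1 HL2 f0 o1 o2.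
move=> /(_ f0); rewrite size_mul ?monic_neq0 ?rprod_monic// !size_rprod z1 z2.
by rewrite addnS /= addSn addnn leqNgt ltnS sf.
Qed.

Lemma orth_factor (a c b : R) L1 L2 m f :
  posfun `]a, c[ L1 -> posfun `]c, b[ L2 ->
  orth L1 m f -> orth L2 m f -> f \is monic -> size f = m.*2.+1 ->
  exists s1 s2, [/\ size s1 = m /\ size s2 = m,
    {in s1, forall x, x \in `]a, c[}, {in s2, forall x, x \in `]c, b[},
    uniq (s1 ++ s2) & f = rprod s1 * rprod s2].
Proof.
move=> HL1 HL2 o1 o2 fm sf.
have [s1 [s2 [[z1 z2] i1 i2 u d]]] :=
  orth_root_dvdp HL1 HL2 (monic_neq0 fm) o1 o2.
exists s1, s2; split=> //.
apply/esym/eqP; rewrite -eqp_monic ?monicMl ?rprod_monic//.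
rewrite -(dvdp_size_eqp d) sf size_mul ?monic_neq0 ?rprod_monic//.
by rewrite !size_rprod z1 z2 addnS /= addSn addnn.
Qed.

(** Bounds on the sizes, rather than exact degrees, make this usable for P - Q and its derivative
    before their top coefficients are known to be nonzero. *)
Lemma coefM_top i j p q : (size p <= i.+1)%N -> (size q <= j.+1)%N ->
  (p * q)`_(i + j) = p`_i * q`_j.
Proof.
move=> sp sq; have ilt : (i < (i + j).+1)%N by rewrite ltnS leq_addr.
rewrite coefM (bigD1 (Ordinal ilt))//= addKn big1 ?addr0// => k.
rewrite -val_eqE /= neq_ltn => /orP[ki|ik].
  rewrite [X in _ * X]nth_default ?mulr0//.
  by rewrite (leq_trans sq)// ltn_subRL ltn_add2r.
by rewrite [X in X * _]nth_default ?mul0r// (leq_trans sp).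
Qed.

Lemma size_polyM_top i j p q : (size p <= i.+1)%N -> (size q <= j.+1)%N ->
  (size (p * q)%R <= (i + j).+1)%N.
Proof.
move=> sp sq; rewrite (leq_trans (size_polyMleq _ _))//.
by rewrite -subn1 leq_subLR add1n -addSn -addnS leq_add.
Qed.
End positive_functionals.

(** * Interlacing *)

Section interlacing.
Variables (R : rcfType) (a c b : R) (L1 L2 : {poly R} -> R) (m : nat).
Hypothesis ac : a < c.
Hypothesis HL1 : posfun `]a, c[ L1.
Hypothesis HL2 : posfun `]c, b[ L2.
Variables P Q : {poly R}.
Hypothesis Pm : P \is monic.
Hypothesis Qm : Q \is monic.
Hypothesis sP : size P = m.+1.*2.+1.
Hypothesis sQ : size Q = m.+1.*2.+1.
Hypothesis P1 : orth (fun f => L1 (('X - a%:P) * f)) m.+1 P.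
Hypothesis P2 : orth (fun f => L2 (('X - a%:P) * f)) m.+1 P.
Hypothesis Q1 : orth L1 m.+1 Q.
Hypothesis Q2 : orth L2 m.+1 Q.

Let H : {poly R} := 'X - a%:P.

Let H0 : H != 0. Proof. by rewrite polyXsubC_eq0. Qed.

Let H1 : {in `]a, c[, forall x, 0 <= H.[x]}.
Proof. by move=> x; rewrite in_itv/= hornerXsubC subr_ge0 => /andP[/ltW]. Qed.

Let H2 : {in `]c, b[, forall x, 0 <= H.[x]}.
Proof.
by move=> x; rewrite in_itv/= hornerXsubC subr_ge0 => /andP[/ltW/(le_trans (ltW ac))].
Qed.

Let rprod1 s : {in s, forall x, x \in `]a, c[} ->
  {in `]c, b[, forall x, 0 <= (rprod s).[x]}.
Proof.
move=> si x; rewrite in_itv/= => /andP[cx _]; apply/ltW/rprod_gt0 => y /si.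
by rewrite in_itv/= => /andP[_ /lt_trans]; apply.
Qed.

Let rprod2 s : {in s, forall x, x \in `]c, b[} ->
  {in `]a, c[, forall x, 0 <= (-1) ^+ size s * (rprod s).[x]}.
Proof.
move=> si x; rewrite in_itv/= => /andP[_ xc]; apply/ltW/rprod_lt => y /si.
by rewrite in_itv/= => /andP[/(lt_trans xc)].
Qed.

Let rprod_neq0 s : rprod s != 0 :> {poly R}.
Proof. by rewrite monic_neq0// rprod_monic. Qed.

Let sign_neq0 (f : {poly R}) k : f != 0 -> (-1) ^+ k *: f != 0.
Proof. by rewrite scaler_eq0 signr_eq0. Qed.

(** Taking for [r] the product over the right zeros of [Q] turns the integrand into a square times
    the factors at the left zeros, which are positive on the right. *)
Lemma orth_next2 r : r \is monic -> size r = m.+2 -> 0 < L2 (Q * r).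
Proof.
move=> rm sr.
have [s1 [s2 [[z1 z2] i1 i2 u e]]] := orth_factor HL1 HL2 Q1 Q2 Qm sQ.
rewrite (orth_monic HL2 Q2 rm (rprod_monic s2)) ?size_rprod ?z2//.
apply: (posfun_gt0 HL2); first by rewrite mulf_neq0 ?rprod_neq0// monic_neq0.
move=> x xI; rewrite e -mulrA -expr2 hornerM mulr_ge0 ?(rprod1 i1)//.
by rewrite horner_exp sqr_ge0.
Qed.

(** The mirror argument with the left zeros; the sign counts the m + 1 factors at the right zeros,
    all negative on the left. *)
Lemma orth_next1 r : r \is monic -> size r = m.+2 ->
  0 < (-1) ^+ m.+1 * L1 (Q * r).
Proof.
move=> rm sr.
have [s1 [s2 [[z1 z2] i1 i2 u e]]] := orth_factor HL1 HL2 Q1 Q2 Qm sQ.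
rewrite (orth_monic HL1 Q1 rm (rprod_monic s1)) ?size_rprod ?z1//.
rewrite -(posfunZ HL1); apply: (posfun_gt0 HL1).
  by rewrite sign_neq0// mulf_neq0 ?rprod_neq0// monic_neq0.
move=> x xI; rewrite e mulrAC -expr2 hornerZ hornerM horner_exp mulrCA.
by rewrite mulr_ge0 ?sqr_ge0// -z2 (rprod2 i2).
Qed.

Section combination.
Variables A B : R.
Hypothesis AB : (A != 0) || (B != 0).
Let F := A *: P + B *: Q.

Let test_size s : size s = m -> size (H * rprod s) = m.+2.
Proof.
by move=> zs; rewrite size_monicM ?monicXsubC ?rprod_neq0// size_XsubC size_rprod zs.
Qed.

Let test_monic s : H * rprod s \is monic.
Proof. by rewrite monicMl ?rprod_monic// monicXsubC. Qed.

(** A test of degree [m] is still annihilated by [P], whereas [H] raises it to degree m + 1 for [Q]: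
    only the next moment of [Q] survives. *)
Lemma combination_test2 s : size s = m ->
  L2 (H * (F * rprod s)) = B * L2 (Q * (H * rprod s)).
Proof.
move=> zs.
have -> : H * (F * rprod s) = A *: (H * (P * rprod s)) + B *: (Q * (H * rprod s)).
  by rewrite /F -!mul_polyC; ring.
by rewrite (posfun_lin HL2) P2 ?mulr0 ?add0r ?(posfunZ HL2)// size_rprod zs.
Qed.

Lemma combination_test1 s : size s = m ->
  L1 (H * (F * rprod s)) = B * L1 (Q * (H * rprod s)).
Proof.
move=> zs.
have -> : H * (F * rprod s) = A *: (H * (P * rprod s)) + B *: (Q * (H * rprod s)).
  by rewrite /F -!mul_polyC; ring.
by rewrite (posfun_lin HL1) P1 ?mulr0 ?add0r ?(posfunZ HL1)// size_rprod zs.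
Qed.

Lemma combination_neq0 : F != 0.
Proof.
(* Any [m] points would do; these give the test polynomial X^m. *)
apply/eqP => F0; have zs : size (nseq m (0:R)) = m by rewrite size_nseq.
have := combination_test2 zs; rewrite F0 mul0r mulr0 (posfun0 HL2) => /esym/eqP.
rewrite mulf_eq0 orbC gt_eqF ?orth_next2 ?test_monic ?test_size//= => /eqP B0.
move: F0 AB; rewrite /F B0 scale0r addr0 eqxx orbF => /eqP.
by rewrite scaler_eq0 (negbTE (monic_neq0 Pm)) orbF => ->.
Qed.

(** The factor [H] uses up one degree of the orthogonality of [Q], which leaves [m] instead of m +
    1. *)
Let orthX L : linear_functional L ->
  orth L m.+1 Q -> orth (fun f => L (H * f)) m.+1 P ->
  orth (fun f => L (H * f)) m F.
Proof.
move=> Ll LQ LP r sr.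
have -> : H * (F * r) = A *: (H * (P * r)) + (B *: (Q * (H * r)) + 0).
  by rewrite /F -!mul_polyC; ring.
rewrite !Ll LP ?(leq_trans sr)// LQ ?linear_functional0 ?mulr0 ?addr0//.
by rewrite (leq_trans (size_polyMleq _ _))// size_XsubC.
Qed.

Lemma combination_orth1 : orth (fun f => L1 (H * f)) m F.
Proof. by apply: orthX => //; exact: posfun_lin HL1. Qed.

Lemma combination_orth2 : orth (fun f => L2 (H * f)) m F.
Proof. by apply: orthX => //; exact: posfun_lin HL2. Qed.

Lemma combination_simple_root x0 : root F x0 -> ~~ root F^`() x0.
Proof.
move=> /factor_theorem[G FG]; apply/negP.
rewrite FG derivM derivXsubC mulr1 rootE hornerD hornerM hornerXsubC subrr.
rewrite mulr0 add0r => /factor_theorem[K GK].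
have {FG GK G}FE : F = ('X - x0%:P) ^+ 2 * K by rewrite FG GK; ring.
have F0 := combination_neq0.
have K0 : K != 0 by apply: contraNneq F0 => K0; rewrite FE K0 mulr0.
(* The squared factor is absorbed into the weight, which it keeps nonnegative; the cofactor [K]
   inherits the orthogonality of [F]. *)
pose W : {poly R} := H * ('X - x0%:P) ^+ 2.
have W0 : W != 0 by rewrite mulf_neq0// expf_neq0// polyXsubC_eq0.
have W1 : {in `]a, c[, forall x, 0 <= W.[x]}.
  by move=> x xI; rewrite hornerM mulr_ge0 ?H1// horner_exp sqr_ge0.
have W2 : {in `]c, b[, forall x, 0 <= W.[x]}.
  by move=> x xI; rewrite hornerM mulr_ge0 ?H2// horner_exp sqr_ge0.
have K1 : orth (fun f => L1 (W * f)) m K.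
  move=> r /combination_orth1; rewrite FE /W => <-; congr L1; ring.
have K2 : orth (fun f => L2 (W * f)) m K.
  move=> r /combination_orth2; rewrite FE /W => <-; congr L2; ring.
have [s1 [s2 [[z1 z2] i1 i2 _ /dvdpP[g Kg]]]] :=
  orth_root_dvdp (posfun_weight HL1 W0 W1) (posfun_weight HL2 W0 W2) K0 K1 K2.
have g0 : g != 0 by apply: contraNneq K0 => g0; rewrite Kg g0 mul0r.
(* [K] has degree at most 2m and already has [m] zeros in each interval. *)
have /size_poly1P[k k0 gk] : size g == 1%N.
  rewrite eqn_leq size_poly_gt0 g0 andbT.
  have : (size F <= m.+1.*2.+1)%N.
    rewrite (leq_trans (size_polyD _ _))// geq_max.
    by rewrite !(leq_trans (size_scale_leq _ _)) ?sP ?sQ.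
  rewrite FE size_monicM ?monic_exp ?monicXsubC// size_exp_XsubC Kg.
  rewrite size_mul ?mulf_neq0 ?rprod_neq0// size_mul ?rprod_neq0// !size_rprod.
  by rewrite z1 z2 addnn doubleS /= addnS /= !addSn add0n /= !ltnS -add1n leq_add2r.
have T2 := combination_test2 z2; have T1 := combination_test1 z1.
have {}T2 : k * L2 (W * (rprod s1 * rprod s2 ^+ 2)) = B * L2 (Q * (H * rprod s2)).
  by rewrite -T2 -(posfunZ HL2) FE Kg gk /W -mul_polyC; congr L2; ring.
have {}T1 : k * ((-1) ^+ m * L1 (W * (rprod s2 * rprod s1 ^+ 2)))
    = - (B * ((-1) ^+ m.+1 * L1 (Q * (H * rprod s1)))).
  rewrite [(-1) ^+ m.+1]exprS mulN1r mulNr mulrN opprK [RHS]mulrCA -T1 mulrCA.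
  rewrite -(posfunZ HL1).
  by rewrite FE Kg gk /W -mul_polyC; congr (_ * _); congr L1; ring.
have := orth_next2 (test_monic s2) (test_size z2).
have := orth_next1 (test_monic s1) (test_size z1).
have : 0 < L2 (W * (rprod s1 * rprod s2 ^+ 2)).
  apply: (posfun_gt0 HL2); first by rewrite mulf_neq0// mulf_neq0// expf_neq0.
  move=> x xI; rewrite hornerM (hornerM (rprod s1)) horner_exp mulr_ge0 ?W2//.
  by rewrite mulr_ge0 ?sqr_ge0// (rprod1 i1).
have : 0 < (-1) ^+ m * L1 (W * (rprod s2 * rprod s1 ^+ 2)).
  rewrite -(posfunZ HL1); apply: (posfun_gt0 HL1).
    by rewrite sign_neq0// mulf_neq0// mulf_neq0// expf_neq0.
  move=> x xI; rewrite hornerZ hornerM (hornerM (rprod s2)) horner_exp mulrCA.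
  by rewrite mulr_ge0 ?W1// mulrA mulr_ge0 ?sqr_ge0// -z2 (rprod2 i2).
move: T1 T2 k0; set u1 := _ * L1 _; set u2 := _ * L1 _.
set u3 := L2 _; set u4 := L2 _.
move=> T1 T2 k0 p1 p3 p2 p4.
(* On the right the test says that [B] has the sign of [k], on the left that it has the opposite
   sign. *)
have [kp|kn] := ltP 0 k.
  have Bp : 0 < B by rewrite -(pmulr_lgt0 _ p4) -T2 mulr_gt0.
  have : 0 < k * u1 by rewrite mulr_gt0.
  by rewrite T1 oppr_gt0 ltNge mulr_ge0// ltW.
have {}kn : k < 0 by rewrite lt_neqAle k0.
have Bp : B < 0 by rewrite -(pmulr_llt0 _ p4) -T2 pmulr_llt0.
have : k * u1 < 0 by rewrite pmulr_llt0.
by rewrite T1 oppr_lt0 ltNge mulr_le0_ge0// ltW.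
Qed.

End combination.

Let W := P^`() * Q - P * Q^`().

(** At a zero of [W] the linear system A P + B Q = A P' + B Q' = 0 is singular, and a nonzero
    solution gives a combination with a double zero. The cases choose this solution: (Q, -P) if it
    is nonzero, else (Q', -P'), else [Q] alone. *)
Lemma wronskian_neq0 x : W.[x] != 0.
Proof.
apply/eqP; rewrite /W hornerD hornerN !hornerM => Wx.
have bad A B : (A != 0) || (B != 0) -> A * P.[x] + B * Q.[x] = 0 ->
    A * P^`().[x] + B * Q^`().[x] = 0 -> False.
  move=> AB e1 e2.
  have := @combination_simple_root _ _ AB x.
  rewrite /root derivD !derivZ !hornerD !hornerZ e1 e2 eqxx => /(_ isT).
  by [].
have [Q0|Qn] := eqVneq Q.[x] 0; last first.
  by apply: (bad Q.[x] (- P.[x])); [rewrite Qn|ring|rewrite -[RHS]Wx; ring].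
have [P0|Pn] := eqVneq P.[x] 0; last first.
  apply: (bad Q.[x] (- P.[x])); [by rewrite oppr_eq0 Pn orbT|ring|].
  by rewrite -[RHS]Wx; ring.
have [Q'0|Q'n] := eqVneq Q^`().[x] 0; last first.
  by apply: (bad Q^`().[x] (- P^`().[x])); [rewrite Q'n|rewrite P0 Q0; ring|ring].
by apply: (bad 0 1); [rewrite oner_eq0 orbT|rewrite Q0; ring|rewrite Q'0; ring].
Qed.

(* [P - Q] is annihilated by one degree less than [P] on each interval, which
   leaves room for a single affine factor, decreasing because of the signs of the
   next moments of [Q]. *)
Lemma subleading_lt0 : (P - Q)`_(m.+1.*2.-1) < 0.
Proof.
have AB : (1 != 0 :> R) || (-1 != 0 :> R) by rewrite oner_eq0.
have DE : P - Q = 1 *: P + (-1) *: Q by rewrite scaleN1r scale1r.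
have D0 := combination_neq0 AB.
have [s1 [s2 [[z1 z2] i1 i2 _ /dvdpP[g]]]] :=
  orth_root_dvdp (posfun_weight HL1 H0 H1) (posfun_weight HL2 H0 H2) D0
    (@combination_orth1 1 (-1)) (@combination_orth2 1 (-1)).
have t2 := @combination_test2 1 (-1) _ z2.
have t1 := @combination_test1 1 (-1) _ z1.
move: D0 t1 t2; rewrite -DE => D0 t1 t2 De.
have Hm s : H * rprod s \is monic by rewrite monicMl ?rprod_monic// monicXsubC.
have Hs s : size s = m -> size (H * rprod s) = m.+2.
  by move=> zs; rewrite size_monicM ?monicXsubC ?rprod_neq0// size_XsubC size_rprod zs.
have g0 : g != 0 by apply: contraNneq D0 => g0; rewrite De g0 mul0r.
have sD : (size (P - Q)%R <= m.+1.*2)%N by exact: size_monicB.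
have sg : (size g <= 2)%N.
  move: sD; rewrite De size_mul ?mulf_neq0 ?rprod_neq0//.
  rewrite size_mul ?rprod_neq0// !size_rprod z1 z2 addnn doubleS /= addnS /=.
  by rewrite -add2n leq_add2r.
(* The other factor is monic of degree 2m, so the coefficient sought is the slope of [g]. *)
have -> : (P - Q)`_(m.+1.*2.-1) = g`_1.
  have -> : (m.+1.*2.-1 = 1 + m.*2)%N by rewrite doubleS.
  have rm : rprod s1 * rprod s2 \is monic by rewrite monicMl ?rprod_monic.
  have rs : size (rprod s1 * rprod s2) = m.*2.+1.
    by rewrite size_mul ?rprod_neq0// !size_rprod z1 z2 addnS /= addSn addnn.
  rewrite De coefM_top ?rs// -[X in _ * _`_X]/(m.*2.+1.-1) -rs -lead_coefE.
  by rewrite (monicP rm) mulr1.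
have gx x : g.[x] = g`_0 + g`_1 * x.
  rewrite (horner_coef_wide _ sg) !big_ord_recl big_ord0 /= expr0 mulr1 addr0.
  by rewrite expr1.
(* Were [g] nonpositive to the left of [c], the left test of P - Q would contradict [orth_next1].
   Likewise [orth_next2] yields a negative value to the right of [c]. *)
have [x1 x1I gx1] : exists2 x, x \in `]a, c[ & 0 < g.[x].
  apply: contrapT => nex.
  have := orth_next1 (Hm s1) (Hs _ z1); rewrite exprS -mulrA mulrCA -t1.
  rewrite -(posfunZ HL1) ltNge => /negP; apply; rewrite -oppr_ge0 -(posfunN HL1).
  apply/ltW/(posfun_gt0 HL1).
    by rewrite oppr_eq0 sign_neq0// De !mulf_neq0.
  move=> x xI; have gx0 : g.[x] <= 0.
    by rewrite leNgt; apply/negP => ?; apply: nex; exists x.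
  have -> : H * ((P - Q) * rprod s1) = H * rprod s1 ^+ 2 * g * rprod s2.
    by rewrite De; ring.
  have := rprod2 i2 xI; have := H1 xI.
  rewrite hornerN hornerZ !(hornerM, horner_exp) z2 => h1 h2.
  rewrite oppr_ge0.
  rewrite (_ : _ * _ = H.[x] * (rprod s1).[x] ^+ 2
    * ((-1) ^+ m * (rprod s2).[x]) * g.[x]); last by ring.
  by rewrite mulr_ge0_le0// mulr_ge0// mulr_ge0// sqr_ge0.
have [x2 x2I gx2] : exists2 x, x \in `]c, b[ & g.[x] < 0.
  apply: contrapT => nex.
  have := orth_next2 (Hm s2) (Hs _ z2); rewrite -[_ < _]oppr_lt0 -mulN1r -t2.
  rewrite ltNge => /negP; apply.
  apply/ltW/(posfun_gt0 HL2); first by rewrite De !mulf_neq0.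
  move=> x xI; have gx0 : 0 <= g.[x].
    by rewrite leNgt; apply/negP => ?; apply: nex; exists x.
  have -> : H * ((P - Q) * rprod s2) = H * rprod s2 ^+ 2 * g * rprod s1.
    by rewrite De; ring.
  have := rprod1 i1 xI; have := H2 xI.
  rewrite !(hornerM, horner_exp) => h1 h2.
  by rewrite mulr_ge0// mulr_ge0// mulr_ge0// sqr_ge0.
move: gx1 gx2 x1I x2I; rewrite !gx !in_itv/= => gx1 gx2 /andP[_ x1c] /andP[cx2 _].
by nra.
Qed.

(** Write n = m + 1 and let d < 0 be the coefficient of x^(2n-1) in P - Q. Expressing [W] through P
    - Q bounds its degree by k = 4n - 2, where its coefficient is (2n - 1) d - 2n d = -d. So [W] is
    positive far to the right, and it has no real zero. *)
Lemma wronskian_gt0 x : 0 < W.[x].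
Proof.
set k := (m.+1.*2.-1.-1 + m.+1.*2)%N.
have sD : (size (P - Q)%R <= m.+1.*2)%N by exact: size_monicB.
have WE : W = P * (P - Q)^`() - P^`() * (P - Q) by rewrite /W derivB; ring.
have Pt : P`_m.+1.*2 = 1.
  by rewrite -[m.+1.*2]/(m.+1.*2.+1.-1) -sP -lead_coefE (monicP Pm).
have sD' : (size (P - Q)^`() <= m.+1.*2.-1)%N.
  by rewrite polyorder.size_deriv -!subn1 leq_sub2r.
have sP' : (size P^`() <= m.+1.*2)%N by rewrite polyorder.size_deriv sP.
have e2 : (m.+1.*2.-1 = m.+1.*2.-1.-1.+1)%N by rewrite doubleS.
have e1 : (m.+1.*2 = m.+1.*2.-1.+1)%N by rewrite doubleS.
have kE : k = (m.+1.*2.-1 + m.+1.*2.-1)%N by rewrite /k doubleS /= addnS.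
have Wk : W`_k = - (P - Q)`_(m.+1.*2.-1).
  have -> : W`_k = P`_m.+1.*2 * (P - Q)^`()`_m.+1.*2.-1.-1
      - P^`()`_m.+1.*2.-1 * (P - Q)`_m.+1.*2.-1.
    rewrite WE coefB; congr (_ - _); last by rewrite kE coefM_top// -e1.
    by rewrite /k addnC coefM_top ?sP// -e2.
  rewrite !coef_deriv -e2 -e1 Pt mul1r; set u := (P - Q)`_ _.
  have -> : 1 *+ m.+1.*2 = 1 *+ m.+1.*2.-1 + 1 :> R by rewrite -mulrSr -e1.
  by rewrite mulrDl mul1r mulr_natl opprD addrA subrr add0r.
have sW : (size W <= k.+1)%N.
  rewrite WE (leq_trans (size_polyD _ _))// geq_max size_polyN; apply/andP; split.
    by rewrite /k addnC; apply: size_polyM_top; rewrite ?sP// -e2.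
  by rewrite kE; apply: size_polyM_top; rewrite -e1.
have lW : 0 < lead_coef W.
  have Wk0 : 0 < W`_k by rewrite Wk oppr_gt0 subleading_lt0.
  have -> // : lead_coef W = W`_k.
  rewrite lead_coefE; congr (_`_ _); apply/eqP; rewrite eqn_leq.
  have kW : (k < size W)%N.
    rewrite ltnNge; apply/negP => /leq_sizeP/(_ _ (leqnn k)) e.
    by rewrite e ltxx in Wk0.
  by rewrite -(ltnS k) -(ltnS _ k) (ltn_predK kW) sW kW.
have [y Wy] := poly_pinfty_gt_lc lW.
set z := Num.max x y.
have Wz : 0 < W.[z] by rewrite (lt_le_trans lW)// Wy// /z le_max lexx orbT.
rewrite ltNge; apply/negP => Wx.
have [||w _] := @poly_ivt _ W x z; first by rewrite /z le_max lexx.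
  by rewrite Wx ltW.
by rewrite rootE (negbTE (wronskian_neq0 w)).
Qed.

(** This is the form in which interlacing is used: at the zeros of [P], [Q] has the sign of P'. *)
Lemma root_deriv_gt0 x : root P x -> 0 < P^`().[x] * Q.[x].
Proof.
move=> /rootP Px; have := wronskian_gt0 x.
by rewrite /W hornerD hornerN !hornerM Px mul0r subr0.
Qed.

End interlacing.

(** * Moment matrix and localisation of zeros *)

Section moments.
Variable R : rcfType.
Implicit Types (L : {poly R} -> R) (f p : {poly R}).

Definition angelesco L1 L2 n p :=
  [/\ p \is monic, size p = n.*2.+1, orth L1 n p & orth L2 n p].

Definition moment L1 L2 n (i : nat) f :=
  if (i < n)%N then L1 (f * 'X^i) else L2 (f * 'X^(i - n)).

(** Rows are indexed by powers, so that the row vector of coefficients of a polynomial times this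
    matrix lists its moments. *)
Definition moment_mx L1 L2 n : 'M[R]_n.*2 :=
  \matrix_(j, i) moment L1 L2 n i 'X^j.

Lemma moment_linear L1 L2 n i : linear_functional L1 -> linear_functional L2 ->
  linear_functional (moment L1 L2 n i).
Proof.
by move=> l1 l2 c p q; rewrite /moment; case: ifP => _; rewrite mulrDl -scalerAl.
Qed.

Lemma linear_functional_coef L k f : linear_functional L -> (size f <= k)%N ->
  L f = \sum_(j < k) f`_j * L 'X^j.
Proof.
move=> lL sf; have {1}-> : f = \poly_(j < k) f`_j.
  apply/polyP => j; rewrite coef_poly; case: ltnP => // kj.
  by rewrite nth_default// (leq_trans sf).
rewrite poly_def.
elim/big_rec2 : _ => [|i y x _ <-]; first exact: linear_functional0.
by rewrite lL.
Qed.

Lemma moment_mxE L1 L2 n f i : linear_functional L1 -> linear_functional L2 ->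
  (size f <= n.*2)%N ->
  (poly_rV f *m moment_mx L1 L2 n) 0 i = moment L1 L2 n i f.
Proof.
move=> l1 l2 sf; rewrite !mxE (linear_functional_coef (moment_linear n i l1 l2) sf).
by apply: eq_bigr => j _; rewrite !mxE.
Qed.

Lemma orth_Xn L n f : linear_functional L ->
  (forall k, (k < n)%N -> L (f * 'X^k) = 0) -> orth L n f.
Proof.
move=> lL Lk r sr.
have lLf : linear_functional (fun r => L (f * r)).
  by move=> c p q; rewrite mulrDr -scalerAr lL.
rewrite (linear_functional_coef lLf sr) big1// => k _.
by rewrite Lk ?mulr0.
Qed.

Lemma orth_moment L1 L2 n f : linear_functional L1 -> linear_functional L2 ->
  (forall i, (i < n.*2)%N -> moment L1 L2 n i f = 0) ->
  orth L1 n f /\ orth L2 n f.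
Proof.
move=> l1 l2 h; split; apply: orth_Xn => // k kn.
  by have := h k; rewrite /moment kn => ->//; rewrite -addnn ltn_addr.
have := h (n + k)%N; rewrite /moment [(n + k < n)%N]ltnNge leq_addr /= addKn => ->//.
by rewrite -addnn ltn_add2l.
Qed.

Variables (a c b : R) (L1 L2 : {poly R} -> R).
Hypothesis HL1 : posfun `]a, c[ L1.
Hypothesis HL2 : posfun `]c, b[ L2.

(** A kernel vector is a polynomial of degree below 2n with all 2n moments zero. *)
Lemma moment_mx_unit n : moment_mx L1 L2 n \in unitmx.
Proof.
rewrite -row_free_unit; apply: inj_row_free => v v0.
have l1 := posfun_lin HL1; have l2 := posfun_lin HL2.
have sv : (size (rVpoly v) <= n.*2)%N by exact: size_poly.
have [k1 k2] : orth L1 n (rVpoly v) /\ orth L2 n (rVpoly v).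
  apply: orth_moment => // i ilt.
  by rewrite -(moment_mxE (Ordinal ilt) l1 l2 sv) rVpolyK v0 mxE.
by rewrite -[v]rVpolyK (orth_eq0 HL1 HL2 k1 k2 sv) linear0.
Qed.

(** Subtract from X^(2n) the polynomial of lower degree with the same moments. *)
Lemma angelesco_exists n : exists p, angelesco L1 L2 n p.
Proof.
have l1 := posfun_lin HL1; have l2 := posfun_lin HL2.
pose v : 'rV[R]_n.*2 := \row_i moment L1 L2 n i 'X^(n.*2).
pose f := rVpoly (v *m invmx (moment_mx L1 L2 n)).
have sf : (size f <= n.*2)%N by exact: size_poly.
have sX : size ('X^(n.*2) - f) = n.*2.+1.
  by rewrite size_polyDl size_polyXn// size_polyN ltnS.
have [k1 k2] : orth L1 n ('X^(n.*2) - f) /\ orth L2 n ('X^(n.*2) - f).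
  apply: orth_moment => // i ilt.
  have lm := moment_linear n i l1 l2.
  rewrite (linear_functionalB _ _ lm).
  rewrite -(moment_mxE (Ordinal ilt) l1 l2 sf) rVpolyK mulmxKV ?moment_mx_unit//.
  by rewrite mxE subrr.
exists ('X^(n.*2) - f); split=> //.
by rewrite monicE lead_coefDl ?lead_coefXn// size_polyXn size_polyN ltnS.
Qed.

End moments.

(** * Locating the ordered zeros by sign changes *)

Section localisation.
Variable R : rcfType.
Implicit Types (p : {poly R}) (s : seq R).

Lemma rootsR_eq p s : p != 0 -> sorted <%R s -> all (root p) s ->
  (size p <= (size s).+1)%N -> rootsR p = s.
Proof.
move=> p0 ss rs sp.
have us := sorted_uniq lt_trans (@ltxx _ R) ss.
have ur : uniq (rootsR p) by exact: uniq_roots.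
apply: (irr_sorted_eq lt_trans (@ltxx _ R)) => //; first exact: sorted_roots.
have sub : {subset s <= rootsR p}.
  by move=> x /(allP rs) px; rewrite -(roots_on_rootsR p0) px.
have [|_ e] := uniq_min_size us sub; last by move=> x; rewrite e.
rewrite -ltnS; apply: leq_trans sp; apply: max_poly_roots => //.
by apply/allP => x; rewrite -(roots_on_rootsR p0) => /andP[].
Qed.

(** The [m] disjoint, ordered intervals each contain a zero, and the degree leaves room for no
    other; hence the position of a zero in the list is the index of its interval. *)
Lemma rootsR_between p (m : nat) (u v : nat -> R) :
  p != 0 -> (size p <= m.+1)%N ->
  (forall k, (k < m)%N -> u k < v k) ->
  (forall k, (k.+1 < m)%N -> v k <= u k.+1) ->
  (forall k, (k < m)%N -> p.[u k] * p.[v k] < 0) ->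
  forall k, (k < m)%N -> u k < (rootsR p)`_k < v k.
Proof.
move=> p0 sp uv vu puv.
have zP k : exists z, (k < m)%N -> u k < z < v k /\ root p z.
  (* [choice] needs a value for every index; 0 fills the irrelevant ones. *)
  have [km|] := boolP (k < m)%N; last by exists 0.
  have [z] := poly_ivtoo (ltW (uv k km)) (puv k km).
  by rewrite in_itv/= => zi pz; exists z.
have [z zm] := choice zP.
have -> : rootsR p = mkseq z m.
  apply: rootsR_eq => //; last by rewrite size_mkseq.
  - apply/(sortedP 0) => i; rewrite size_mkseq => im.
    rewrite !nth_mkseq ?(ltnW im)//.
    have [/andP[_ zv] _] := zm _ (ltnW im); have [/andP[uz _] _] := zm _ im.
    exact: lt_trans (lt_le_trans zv (vu _ im)) uz.
  - apply/(all_nthP 0) => i; rewrite size_mkseq => im; rewrite nth_mkseq//.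
    by have [] := zm _ im.
by move=> k km; rewrite nth_mkseq//; have [] := zm _ km.
Qed.

(** At a root the derivative is the product of its differences to the other roots, and the exponent
    counts the larger roots. *)
Lemma deriv_rprod_sign s k : sorted <%R s -> (k < size s)%N ->
  0 < (-1) ^+ (size s - k.+1) * (rprod s)^`().[s`_k].
Proof.
elim: s k => // x s ih [|k] /= ps; rewrite ?ltnS => ks;
  rewrite /rprod big_cons -/(rprod s) derivM derivXsubC mul1r hornerD hornerM
    hornerXsubC.
  rewrite subrr mul0r addr0 subn1 /=; apply: rprod_lt => y ys.
  by move: ps; rewrite (path_sortedE lt_trans) => /andP[/allP/(_ y ys)].
have sk : s`_k \in s by exact: mem_nth.
have -> : (rprod s).[s`_k] = 0.
  by apply/rootP; rewrite root_prod_XsubC.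
rewrite add0r subSS mulrCA mulr_gt0 ?ih ?(path_sorted ps)// subr_gt0.
by move: ps; rewrite (path_sortedE lt_trans) => /andP[/allP/(_ _ sk)].
Qed.

Lemma rprod_rootsR p m : p \is monic -> size p = m.+1 ->
  (exists s, [/\ uniq s, size s = m & p = rprod s]) ->
  [/\ sorted <%R (rootsR p), size (rootsR p) = m & p = rprod (rootsR p)].
Proof.
move=> pm sp [s [us ss pE]].
have e : rootsR p = sort <=%R s.
  apply: rootsR_eq; rewrite ?monic_neq0 ?size_sort ?sp ?ss//.
    by rewrite sort_lt_sorted.
  by apply/allP => x; rewrite mem_sort pE root_prod_XsubC.
rewrite e sort_lt_sorted us size_sort ss; split=> //.
by rewrite {1}pE /rprod; apply/perm_big; rewrite perm_sym perm_sort.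
Qed.

(** The hypothesis says that at each point of [s] the sign of [q] is opposite to that of the
    derivative of [rprod s]. So [q] alternates along [s] and is negative at its last point, which
    traps one zero of [q] to the right of each point. *)
Lemma rootsR_lt s q : sorted <%R s -> q \is monic -> size q = (size s).+1 ->
  (forall k, (k < size s)%N -> (-1) ^+ (size s - k.+1) * q.[s`_k] < 0) ->
  forall k, (k < size s)%N -> s`_k < (rootsR q)`_k.
Proof.
move=> ss qm sq sgn.
have lq : 0 < lead_coef q by rewrite (monicP qm).
have [y0 qy] := poly_pinfty_gt_lc lq.
pose y := Num.max y0 (last 0 s + 1).
have qy0 : 0 < q.[y] by rewrite (lt_le_trans lq)// qy// le_max lexx.
(* The last interval ends at [y], beyond all of [s], where the monic [q] is already positive. *)
pose v k := if (k.+1 < size s)%N then s`_k.+1 else y.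
have uv k : (k < size s)%N -> s`_k < v k.
  move=> ks; rewrite /v; case: ifP => [ks1|]; first exact: (sortedP 0 ss).
  move/negbT; rewrite -leqNgt => sk.
  have sE : size s = k.+1 by apply/eqP; rewrite eqn_leq sk ks.
  have -> : s`_k = last 0 s by rewrite -nth_last sE.
  by rewrite lt_max ltrDl ltr01 orbT.
have vu k : (k.+1 < size s)%N -> v k <= s`_k.+1 by rewrite /v => ->.
have qs k : (k < size s)%N -> q.[s`_k] * q.[v k] < 0.
  move=> ks; have := sgn k ks; rewrite /v; case: ifP => [ks1|/negbT].
    have := sgn _ ks1; rewrite -(subnSK ks1) exprS mulN1r mulNr oppr_lt0.
    set t := (-1) ^+ _ => h1 h2.
    have : (t * q.[s`_k]) * (t * q.[s`_k.+1]) < 0 by rewrite pmulr_rlt0.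
    by rewrite mulrACA -expr2 sqrr_sign mul1r.
  rewrite -leqNgt => sk; have -> : (size s - k.+1 = 0)%N by apply/eqP; rewrite subn_eq0.
  by rewrite expr0 mul1r => h; rewrite pmulr_llt0.
move=> k ks.
have := @rootsR_between q (size s) (nth 0 s) v (monic_neq0 qm) _ uv vu qs k ks.
by rewrite sq leqnn => /(_ isT)/andP[].
Qed.
End localisation.

(** * Jacobi-type weights *)

Section integrability.
Variable R : realType.
Notation mu := (@lebesgue_measure R).

(** On compact subintervals the integral is a difference of two values of [F], hence at most 2M;
    monotone convergence passes to the open interval, where [f] may blow up at the ends. *)
Lemma integrable_primitive (f F : R -> R) (u v M : R) :
  (forall x, u < x < v -> 0 <= f x) ->
  (forall x, u < x < v -> {for x, continuous f}) ->
  (forall x, u < x < v -> is_derive x 1 F (f x)) ->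
  (forall x, u < x < v -> `|F x| <= M) ->
  mu.-integrable `]u, v[ (EFin \o f).
Proof.
move=> f0 cf dF FM.
have [uv|vu] := ltP u v; last first.
  by rewrite set_itv_ge ?bnd_simp -?leNgt//; exact: integrable_set0.
have mf : measurable_fun `]u, v[ f.
  apply: open_continuous_measurable_fun => //.
  by move=> x; rewrite inE/= in_itv/=; exact: cf.
(* A denominator of at least 3 keeps u + d n < v - d n from n = 0 on. *)
pose d n : R := (v - u) / n.+3%:R.
have d0 n : 0 < d n by rewrite divr_gt0 ?subr_gt0// ltr0n.
have d3 n : d n * 3 <= v - u.
  by rewrite /d mulrAC ler_pdivrMr ?ltr0n// ler_wpM2l ?subr_ge0 ?(ltW uv)// ler_nat.
have dS n m : (n <= m)%N -> d m <= d n.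
  by move=> nm; rewrite ler_wpM2l ?subr_ge0 ?(ltW uv)// lef_pV2 ?posrE ?ltr0n// ler_nat !ltnS.
pose K n : set R := `[u + d n, v - d n]%classic.
have KD n x : K n x -> u < x < v.
  by rewrite /K/= in_itv/= => /andP[h1 h2]; have := d0 n => h; apply/andP; split; lra.
have Kuv : \bigcup_n K n = `]u, v[%classic.
  apply/seteqP; split => [x [n _ /KD]|x]; first by rewrite /= in_itv.
  rewrite /= in_itv/= => /andP[ux xv].
  have e0 : 0 < Num.min (x - u) (v - x) by rewrite lt_min !subr_gt0 ux.
  pose n := Num.truncn ((v - u) / Num.min (x - u) (v - x)).
  exists n => //; rewrite /K /= in_itv/=.
  have dn : d n <= Num.min (x - u) (v - x).
    rewrite /d ler_pdivrMr ?ltr0n// mulrC -ler_pdivrMr//.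
    by rewrite (le_trans (ltW (truncnS_gt _)))// ler_nat -/n -addn3 addnS ltnS leq_addr.
  by move: dn; rewrite le_min => /andP[h1 h2]; apply/andP; split; lra.
apply/integrableP; split; first exact/measurable_EFinP.
have -> : (\int[mu]_(x in `]u, v[) `|(EFin \o f) x|
    = \int[mu]_(x in \bigcup_n K n) (EFin \o f) x)%E.
  rewrite Kuv; apply: eq_integral => x; rewrite inE/= in_itv/= => xuv.
  by rewrite /= ger0_norm ?f0.
have bound n : (\int[mu]_(x in K n) (EFin \o f) x <= (2 * M)%:E)%E.
  have lr : u + d n < v - d n by have := d3 n; have := d0 n => *; lra.
  have inK x : u + d n <= x <= v - d n -> u < x < v.
    by move=> h; apply: (KD n); rewrite /K/= in_itv.
  rewrite (continuous_FTC2 (F := F) lr).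
  - rewrite -EFinB lee_fin.
    have := FM (u + d n); have := FM (v - d n); rewrite !ler_norml.
    move=> /(_ (inK _ _)) h1 /(_ (inK _ _)) h2.
    have /andP[_ ?] := h1 ltac:(by rewrite lexx (ltW lr)).
    have /andP[? _] := h2 ltac:(by rewrite lexx (ltW lr)).
    by lra.
  - apply: continuous_in_subspaceT => x; rewrite inE/= in_itv/= => xK.
    exact/cf/inK.
  - split.
    + move=> x; rewrite in_itv/= => /andP[/ltW h1 /ltW h2].
      by have [] := dF x (inK x _); rewrite ?h1 ?h2.
    + apply: cvg_at_right_filter; apply: differentiable_continuous.
      by apply/derivable1_diffP; have [] := dF (u + d n) (inK _ _); rewrite ?lexx ?(ltW lr).
    + apply: cvg_at_left_filter; apply: differentiable_continuous.
      by apply/derivable1_diffP; have [] := dF (v - d n) (inK _ _); rewrite ?lexx ?(ltW lr).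
  - move=> x; rewrite in_itv/= => /andP[/ltW h1 /ltW h2].
    have xuv : u < x < v by apply: inK; rewrite h1 h2.
    by rewrite derive1E; exact: (@derive_val _ _ _ _ _ _ _ (dF x xuv)).
apply: le_lt_trans (ltry (2 * M)).
have cvgK := @ge0_nondecreasing_set_cvg_integral _ (measurableTypeR R) R K
  (EFin \o f) mu.
apply: (cvge_to_le (cvgK _ _ _ _)).
- apply/nondecreasing_seqP => n; rewrite subsetEset; apply: subset_itv;
    by rewrite bnd_simp ?lerD2l ?lerN2 dS.
- by move=> n; exact: measurable_itv.
- move=> n; apply/measurable_EFinP; apply: measurable_funS mf => // x /KD.
  by rewrite /= in_itv.
- by move=> n x /KD/f0; rewrite lee_fin.
- exact: nearW.
Qed.
(** The power is monotone in [t], in a direction given by the sign of [e]; the sum of both end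
    values bounds it in either case. *)
Lemma powR_le_sum (l h t e : R) : 0 < l -> l <= t <= h ->
  t `^ e <= l `^ e + h `^ e.
Proof.
move=> l0 /andP[lt th]; have t0 := lt_le_trans l0 lt; have h0 := lt_le_trans t0 th.
have [e0|e0] := leP 0 e.
  rewrite (le_trans (ge0_ler_powR e0 _ _ th)) ?nnegrE ?(ltW h0) ?(ltW t0)//.
  by rewrite lerDr powR_ge0.
have E x : x `^ e = (x `^ (- e))^-1 by rewrite -powRN opprK.
rewrite !E; apply: (@le_trans _ _ (l `^ (- e))^-1).
  rewrite lef_pV2 ?posrE ?powR_gt0//.
  by rewrite ge0_ler_powR ?nnegrE ?oppr_ge0 ?(ltW e0) ?(ltW l0) ?(ltW t0).
by rewrite lerDl invr_ge0 powR_ge0.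
Qed.

Lemma continuous_powR_comp (e : R) (g : R -> R) (x : R) :
  0 < g x -> {for x, continuous g} -> {for x, continuous (fun y => g y `^ e)}.
Proof.
move=> gx cg.
have ct : {for g x, continuous (fun t : R => t `^ e)}.
  apply: differentiable_continuous; apply/derivable1_diffP.
  by apply: derivable_powR; rewrite in_itv/= gx.
exact: (cvg_comp _ _ cg ct).
Qed.

Lemma integrable_powR_left (u v e : R) : -1 < e ->
  mu.-integrable `]u, v[ (EFin \o (fun x => (x - u) `^ e)).
Proof.
move=> e1; have e1n : e + 1 != 0 by rewrite gt_eqF// -ltrBlDr sub0r.
have e10 : 0 <= e + 1 by lra.
apply: (@integrable_primitive (fun x => (x - u) `^ e)
  (fun x => (e + 1)^-1 * (x - u) `^ (e + 1)) u v
  ((e + 1)^-1 * (v - u) `^ (e + 1))).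
- by move=> x _; exact: powR_ge0.
- move=> x /andP[ux _]; apply: continuous_powR_comp; first by rewrite subr_gt0.
  by apply: cvgB; [exact: cvg_id|exact: cvg_cst].
- move=> x /andP[ux _]; have xu : 0 < x - u by rewrite subr_gt0.
  have d1 : is_derive x 1 (fun x => x - u) (1 - 0) by exact: is_deriveB.
  have d2 : is_derive x 1 ((fun t : R => t `^ (e + 1)) \o (fun x => x - u))
      ((e + 1) * (x - u) `^ (e + 1 - 1) * (1 - 0)).
    by apply: is_derive1_comp; exact: is_derive1_powR.
  have d3 := is_deriveZ (e + 1)^-1 d2.
  apply: is_derive_eq d3 _.
  by rewrite addrK subr0 mulr1 /GRing.scale/= mulrA mulVf// mul1r.
- move=> x /andP[ux xv]; rewrite ger0_norm ?mulr_ge0 ?invr_ge0 ?powR_ge0//.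
  rewrite ler_wpM2l ?invr_ge0// (ge0_ler_powR e10) ?nnegrE ?subr_ge0 ?ltW//.
  - exact: lt_trans ux xv.
  - by rewrite ltrD2r.
Qed.

Lemma integrable_powR_right (u v e : R) : -1 < e ->
  mu.-integrable `]u, v[ (EFin \o (fun x => (v - x) `^ e)).
Proof.
move=> e1; have e1n : e + 1 != 0 by rewrite gt_eqF// -ltrBlDr sub0r.
have e10 : 0 <= e + 1 by lra.
apply: (@integrable_primitive (fun x => (v - x) `^ e)
  (fun x => (- (e + 1)^-1) * (v - x) `^ (e + 1)) u v
  ((e + 1)^-1 * (v - u) `^ (e + 1))).
- by move=> x _; exact: powR_ge0.
- move=> x /andP[_ xv]; apply: continuous_powR_comp; first by rewrite subr_gt0.
  by apply: cvgB; [exact: cvg_cst|exact: cvg_id].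
- move=> x /andP[_ xv]; have vx : 0 < v - x by rewrite subr_gt0.
  have d1 : is_derive x 1 (fun x => v - x) (0 - 1) by exact: is_deriveB.
  have d2 : is_derive x 1 ((fun t : R => t `^ (e + 1)) \o (fun x => v - x))
      ((e + 1) * (v - x) `^ (e + 1 - 1) * (0 - 1)).
    by apply: is_derive1_comp; exact: is_derive1_powR.
  have d3 := is_deriveZ (- (e + 1)^-1) d2.
  apply: is_derive_eq d3 _.
  rewrite addrK sub0r mulrN1 scalerN scaleNr opprK /GRing.scale/= mulrA.
  by rewrite mulVf// mul1r.
- move=> x /andP[ux xv]; rewrite normrM normrN !ger0_norm ?powR_ge0 ?invr_ge0//.
  rewrite ler_wpM2l ?invr_ge0//.
  rewrite (ge0_ler_powR e10) ?nnegrE ?subr_ge0 ?ltW//.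
  - exact: lt_trans ux xv.
  - by rewrite ltrD2l ltrN2.
Qed.

Lemma measurable_powR_sub (D : set R) (u e : R) :
  measurable_fun D (fun x => (x - u) `^ e).
Proof.
apply: measurable_funTS.
have ms : measurable_fun [set: R] (fun x : R => x - u) by exact: measurable_funB.
exact: (measurableT_comp (measurable_powR e) ms).
Qed.

Lemma measurable_powR_subr (D : set R) (v e : R) :
  measurable_fun D (fun x => (v - x) `^ e).
Proof.
apply: measurable_funTS.
have ms : measurable_fun [set: R] (fun x : R => v - x) by exact: measurable_funB.
exact: (measurableT_comp (measurable_powR e) ms).
Qed.

(** On the half next to one endpoint, the distance to the other one stays between (v - u) / 2 and v
    - u, so its power is bounded by the constant [c]. *)
Lemma integrable_beta (u v e1 e2 : R) : -1 < e1 -> -1 < e2 ->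
  mu.-integrable `]u, v[ (EFin \o (fun x => (x - u) `^ e1 * (v - x) `^ e2)).
Proof.
move=> he1 he2.
have [uv|vu] := ltP u v; last first.
  by rewrite set_itv_ge ?bnd_simp -?leNgt//; exact: integrable_set0.
pose c e := ((v - u) / 2) `^ e + (v - u) `^ e.
have c0 e : 0 <= c e by rewrite addr_ge0 ?powR_ge0.
apply: (@le_integrable _ _ _ mu `]u, v[ _ _ (EFin \o (fun x =>
   c e2 * (x - u) `^ e1 + c e1 * (v - x) `^ e2))) => //.
- apply/measurable_EFinP; apply: measurable_funM.
    exact: measurable_powR_sub.
  exact: measurable_powR_subr.
- move=> x; rewrite /= in_itv/= lee_fin => /andP[ux xv].
  rewrite !ger0_norm ?addr_ge0 ?mulr_ge0 ?c0 ?powR_ge0//.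
  have [h|h] := leP (x - u) (v - x).
    apply: (@le_trans _ _ (c e2 * (x - u) `^ e1)); last first.
      by rewrite lerDl mulr_ge0 ?powR_ge0.
    rewrite mulrC ler_wpM2r ?powR_ge0// powR_le_sum//; first by lra.
    by apply/andP; split; lra.
  apply: (@le_trans _ _ (c e1 * (v - x) `^ e2)); last first.
    by rewrite lerDr mulr_ge0 ?powR_ge0.
  rewrite ler_wpM2r ?powR_ge0// powR_le_sum//; first by lra.
  by apply/andP; split; lra.
- rewrite (_ : _ \o _ = (fun x => (c e2)%:E * ((x - u) `^ e1)%:E) \+
     (fun x => (c e1)%:E * ((v - x) `^ e2)%:E))%E.
    apply: integrableD => //; apply: integrableZl => //.
      exact: integrable_powR_left.
    exact: integrable_powR_right.
  by apply/funext => x /=; rewrite EFinD !EFinM.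
Qed.

Lemma integrable_bddM (D : set R) (f g : R -> R) (M : R) :
  measurable D -> mu.-integrable D (EFin \o f) -> measurable_fun D g ->
  (forall x, D x -> `|g x| <= M) ->
  mu.-integrable D (EFin \o (fun x => g x * f x)).
Proof.
move=> mD fi mg gM.
have -> : EFin \o (fun x => g x * f x) = ((EFin \o g) \* (EFin \o f))%E.
  by apply/funext => x /=; rewrite EFinM.
apply: integrableMr => //; exists M; split; first exact: num_real.
by move=> y My x Dx; apply: le_trans (gM x Dx) _; exact: ltW.
Qed.

Lemma poly_bounded (p : {poly R}) (u v : R) :
  exists M, forall x, u < x < v -> `|p.[x]| <= M.
Proof.
have [r [ru rv]] : exists r, `|u| <= r /\ `|v| <= r.
  by exists (Num.max `|u| `|v|); rewrite !le_max !lexx orbT.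
have r0 : 0 <= r by apply: le_trans ru.
exists (\sum_(i < size p) `|p`_i| * r ^+ i) => x /andP[ux xv].
rewrite horner_coef (le_trans (ler_norm_sum _ _ _))// ler_sum// => i _.
rewrite normrM normrX ler_wpM2l// lerXn2r ?nnegrE//.
rewrite ler_norml; have := ler_norm v; have := ler_norm (- u); rewrite normrN.
by move=> *; apply/andP; split; lra.
Qed.

Lemma measurable_horner (p : {poly R}) (D : set R) : measurable_fun D (horner p).
Proof.
apply: measurable_funTS; apply: continuous_measurable_fun; exact: continuous_horner.
Qed.

Lemma integrable_poly_weight (w : R -> R) (u v : R) (p : {poly R}) :
  mu.-integrable `]u, v[ (EFin \o w) ->
  mu.-integrable `]u, v[ (EFin \o (fun x => p.[x] * w x)).
Proof.
move=> wi; have [M pM] := poly_bounded p u v.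
apply: (integrable_bddM (M := M)) => //; first exact: measurable_horner.
Qed.

(** For strict positivity: a zero integral would make the integrand vanish almost everywhere, and
    since w > 0 the interval would be covered by a null set and the finitely many roots of [p]. *)
Lemma posfun_integral (w : R -> R) (u v : R) :
  u < v -> mu.-integrable `]u, v[ (EFin \o w) ->
  (forall x, u < x < v -> 0 < w x) ->
  posfun `]u, v[%R (fun p => \int[mu]_(x in `]u, v[) (p.[x] * w x)).
Proof.
move=> uv wi w0.
have pi p := integrable_poly_weight p wi.
split=> [c p q|p p0 pI].
  under eq_Rintegral do rewrite hornerD hornerZ mulrDl -mulrA.
  rewrite RintegralD// ?RintegralZl//.
  rewrite (_ : _ \o _ = (fun x => c%:E * (p.[x] * w x)%:E)%E).
    by apply: integrableZl => //; exact: pi.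
  by apply/funext => x /=; rewrite EFinM.
have ge0 x : `]u, v[%classic x -> 0 <= p.[x] * w x.
  move=> xI; rewrite mulr_ge0//; first exact: pI.
  by apply/ltW/w0; move: xI; rewrite /= in_itv.
rewrite lt_neqAle Rintegral_ge0// andbT eq_sym; apply/negP => /eqP I0.
have /integrableP[mpw _] := pi p.
have : (\int[mu]_(x in `]u, v[) `|(p.[x] * w x)%:E| = 0)%E.
  transitivity (\int[mu]_(x in `]u, v[) (p.[x] * w x)%:E)%E.
    by apply: eq_integral => x; rewrite inE => xI; rewrite /= ger0_norm// ge0.
  rewrite -[LHS]fineK; last by apply: (integrable_fin_num _ (pi p)).
  by rewrite -[fine _]/(Rintegral _ _ _) I0.
move/(ae_eq_integral_abs mu (measurable_itv _) mpw) => [N [mN N0 sN]].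
have fin_roots : finite_set [set x | root p x].
  apply: (sub_finite_set _ (finite_seq (rootsR p))) => x /= px.
  by rewrite -roots_on_rootsR.
have sub : (`]u, v[ `<=` N `|` [set x | root p x])%classic.
  move=> x xI; have [px|px] := boolP (root p x); [by right|left].
  apply: sN => /= /(_ xI)/eqP; rewrite eqe mulf_eq0 => /orP[|]; first exact/negP.
  by rewrite gt_eqF// w0//; move: xI; rewrite /= in_itv.
have mroots : measurable [set x | root p x].
  exact: countable_measurable (finite_set_countable fin_roots).
have NZ0 : mu (N `|` [set x | root p x]) = 0%E.
  apply: null_set_setU => //.
  exact: (countable_lebesgue_measure0 (finite_set_countable fin_roots)).
have m0 : lebesgue_measure (`]u, v[%classic : set R) = 0%E.
  exact: (subset_measure0 (mu := mu) _ (measurableU _ _ mN mroots) sub NZ0).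
move/eqP: m0; rewrite lebesgue_measure_itv/= lte_fin uv -EFinB eqe subr_eq0.
by rewrite gt_eqF.
Qed.
End integrability.

(** * The two Angelesco-Jacobi functionals *)

Section functionals.
Variables (R : realType) (alpha gamma : R).
Hypothesis halpha : -1 < alpha.
Hypothesis hgamma : -1 < gamma.
Notation mu := (@lebesgue_measure R).
Implicit Types (a b beta x : R) (p : {poly R}).

Definition aj_weight beta a x :=
  (1 - x) `^ alpha * (x - a) `^ beta * `|x| `^ gamma.

Definition aj_left beta a p :=
  \int[mu]_(x in `]a, 0[) (p.[x] * aj_weight beta a x).

Definition aj_right beta a p :=
  \int[mu]_(x in `]0, 1[) (p.[x] * aj_weight beta a x).

Lemma aj_weight_integrable_left beta a : -1 < beta ->
  mu.-integrable `]a, 0[ (EFin \o aj_weight beta a).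
Proof.
move=> hbeta.
have h : mu.-integrable `]a, 0[ (EFin \o
    (fun x => (1 - x) `^ alpha * ((x - a) `^ beta * (0 - x) `^ gamma))).
  (* Only the factors at [a] and 0 can blow up here, as 1 - x lies between 1 and 1 - a. *)
  apply: (integrable_bddM (M := 1 `^ alpha + (1 - a) `^ alpha)) => //.
  - exact: integrable_beta.
  - exact: measurable_powR_subr.
  - move=> x; rewrite /= in_itv/= => /andP[ax x0].
    by rewrite ger0_norm ?powR_ge0// powR_le_sum//; apply/andP; split; lra.
apply: eq_integrable h => // x; rewrite inE/= in_itv/= => /andP[_ x0].
by rewrite /aj_weight mulrA sub0r ltr0_norm.
Qed.

Lemma aj_weight_integrable_right beta a : a < 0 ->
  mu.-integrable `]0, 1[ (EFin \o aj_weight beta a).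
Proof.
move=> a0.
have h : mu.-integrable `]0, 1[ (EFin \o
    (fun x => (x - a) `^ beta * ((x - 0) `^ gamma * (1 - x) `^ alpha))).
  (* On this side x - a lies between -a > 0 and 1 - a, whatever the sign of [beta]. *)
  apply: (integrable_bddM (M := (- a) `^ beta + (1 - a) `^ beta)) => //.
  - exact: integrable_beta.
  - exact: measurable_powR_sub.
  - move=> x; rewrite /= in_itv/= => /andP[x0 x1].
    by rewrite ger0_norm ?powR_ge0// powR_le_sum// ?oppr_gt0//; apply/andP; split; lra.
apply: eq_integrable h => // x; rewrite inE/= in_itv/= => /andP[x0 _].
by rewrite /aj_weight subr0 (gtr0_norm x0); congr EFin; ring.
Qed.

Lemma aj_weight_gt0 beta a x : a < x < 1 -> x != 0 -> 0 < aj_weight beta a x.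
Proof.
move=> /andP[ax x1] x0; rewrite /aj_weight.
by rewrite !mulr_gt0 ?powR_gt0 ?subr_gt0 ?normr_gt0.
Qed.

Lemma posfun_left beta a : a < 0 -> -1 < beta -> posfun `]a, 0[%R (aj_left beta a).
Proof.
move=> a0 hbeta; apply: posfun_integral => //; first exact: aj_weight_integrable_left.
move=> x /andP[ax x0]; apply: aj_weight_gt0; last by rewrite lt_eqF.
by rewrite ax (lt_trans x0).
Qed.

Lemma posfun_right beta a : a < 0 -> posfun `]0, 1[%R (aj_right beta a).
Proof.
move=> a0; apply: posfun_integral => //; first exact: aj_weight_integrable_right.
move=> x /andP[x0 x1]; apply: aj_weight_gt0; last by rewrite gt_eqF.
by rewrite x1 (lt_trans a0).
Qed.

Lemma aj_weightS beta a x : a < x ->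
  aj_weight (beta + 1) a x = (x - a) * aj_weight beta a x.
Proof.
move=> ax; rewrite /aj_weight powRD; last first.
  by apply/implyP => _; rewrite subr_eq0 gt_eqF.
by rewrite powRr1 ?subr_ge0 ?ltW//; ring.
Qed.

Lemma aj_leftS beta a p :
  aj_left (beta + 1) a p = aj_left beta a (('X - a%:P) * p).
Proof.
apply: eq_Rintegral => x; rewrite inE/= in_itv/= => /andP[ax _].
by rewrite aj_weightS// hornerM hornerXsubC; ring.
Qed.

Lemma aj_rightS beta a p : a < 0 ->
  aj_right (beta + 1) a p = aj_right beta a (('X - a%:P) * p).
Proof.
move=> a0; apply: eq_Rintegral => x; rewrite inE/= in_itv/= => /andP[x0 _].
by rewrite aj_weightS ?(lt_trans a0)// hornerM hornerXsubC; ring.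
Qed.

(** The real-valued integral sends infinite values to 0; integrability excludes them. *)
Lemma Rintegral_eq0 (D : set R) (f : R -> R) : measurable D ->
  mu.-integrable D (EFin \o f) ->
  (\int[mu]_(x in D) (f x)%:E = 0)%E <-> \int[mu]_(x in D) f x = 0.
Proof.
move=> mD fi; split=> [|f0]; first by rewrite /Rintegral => ->.
by rewrite -[LHS]fineK ?[fine _]f0//; apply: (integrable_fin_num _ fi).
Qed.

Lemma is_angelesco_jacobiE n beta a p : a < 0 -> -1 < beta ->
  is_angelesco_jacobi n alpha beta gamma a p <->
  angelesco (aj_left beta a) (aj_right beta a) n p.
Proof.
move=> a0 hbeta.
have l1 := posfun_lin (posfun_left a0 hbeta).
have l2 := posfun_lin (posfun_right beta a0).
have i1 q := integrable_poly_weight q (aj_weight_integrable_left a hbeta).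
have i2 q := integrable_poly_weight q (aj_weight_integrable_right beta a0).
have eql k : (\int[mu]_(x in `]a, 0%R[) (x ^+ k * p.[x] * (1 - x) `^ alpha *
     (x - a) `^ beta * `|x| `^ gamma)%:E = 0)%E <-> aj_left beta a (p * 'X^k) = 0.
  rewrite -Rintegral_eq0//.
  rewrite (@eq_integral _ _ _ mu `]a, 0%R[
    (fun x => ((p * 'X^k).[x] * aj_weight beta a x)%:E))//.
  move=> x _; rewrite hornerM hornerXn /aj_weight; congr EFin; ring.
have eqr k : (\int[mu]_(x in `]0%R, 1%R[) (x ^+ k * p.[x] * (1 - x) `^ alpha *
     (x - a) `^ beta * x `^ gamma)%:E = 0)%E <-> aj_right beta a (p * 'X^k) = 0.
  rewrite -Rintegral_eq0//.
  rewrite (@eq_integral _ _ _ mu `]0%R, 1%R[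
    (fun x => ((p * 'X^k).[x] * aj_weight beta a x)%:E))//.
  move=> x; rewrite inE/= in_itv/= => /andP[x0 _].
  by rewrite hornerM hornerXn /aj_weight (gtr0_norm x0); congr EFin; ring.
split=> [[pm sp o]|[pm sp o1 o2]]; split=> //.
- by apply: orth_Xn => // k /o[/eql].
- by apply: orth_Xn => // k /o[_ /eqr].
- by move=> k kn; split; [apply/eql/o1|apply/eqr/o2]; rewrite size_polyXn.
Qed.
End functionals.

(** * Dependence of the moments on the endpoint *)

Section positive_part_power.
Variables (R : realType) (B : R).
Hypothesis B0 : 0 < B.
Notation mu := (@lebesgue_measure R).

(** The truncated power. With it an integral over ]b, 0[ becomes one over a fixed domain, and [b]
    occurs in the integrand only. *)
Definition pospow (t : R) : R := Num.max 0 t `^ B.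

Lemma pospow_ge0 t : 0 <= pospow t.
Proof. exact: powR_ge0. Qed.

Lemma pospow_le0 (t : R) : t <= 0 -> pospow t = 0.
Proof. by move=> t0; rewrite /pospow max_l// powR0// gt_eqF. Qed.

Lemma pospow_gt0 (t : R) : 0 < t -> pospow t = t `^ B.
Proof. by move=> t0; rewrite /pospow max_r// ltW. Qed.

Lemma ler_pospow : {homo pospow : s t / s <= t}.
Proof.
move=> s t st.
have h : Num.max 0 s <= Num.max 0 t by rewrite ge_max !le_max lexx st orbT.
by apply: (ge0_ler_powR (ltW B0) _ _ h); rewrite nnegrE le_max lexx.
Qed.

Lemma pospow_continuous : continuous pospow.
Proof.
move=> t; have [t0|t0|->] := ltgtP t 0.
- have e : \forall s \near t, 0 = pospow s.
    by near=> s; rewrite pospow_le0// ltW//; near: s; exact: lt_nbhsl.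
  rewrite /continuous_at (pospow_le0 (ltW t0)).
  exact: cvg_trans (near_eq_cvg e) (cvg_cst _).
- have e : \forall s \near t, s `^ B = pospow s.
    by near=> s; rewrite pospow_gt0//; near: s; exact: lt_nbhsr.
  rewrite /continuous_at (pospow_gt0 t0); apply: cvg_trans (near_eq_cvg e) _.
  exact: (@continuous_powR_comp R B id t t0 (@cvg_id _ _)).
- rewrite /continuous_at (pospow_le0 (lexx 0)); apply/cvgrPdist_lt => /= e e0.
  (* The B-th root of [e] is the required neighbourhood radius at 0. *)
  have d0 : 0 < e `^ B^-1 by rewrite powR_gt0.
  near=> s; rewrite sub0r normrN ger0_norm ?pospow_ge0//.
  have -> : e = (e `^ B^-1) `^ B by rewrite -powRrM mulVf ?gt_eqF// powRr1// ltW.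
  rewrite /pospow gt0_ltr_powR ?nnegrE ?le_max ?lexx ?powR_ge0// gt_max d0/=.
  by near: s; exact: lt_nbhsl.
Unshelve. all: by end_near. Qed.

Lemma is_derive_pospow (t : R) : 0 < t -> is_derive t 1 pospow (B * t `^ (B - 1)).
Proof.
move=> t0; apply: near_eq_is_derive (is_derive1_powR B t0).
by near=> s; rewrite pospow_gt0//; near: s; exact: lt_nbhsr.
Unshelve. all: by end_near. Qed.

(** Bounds the difference quotients uniformly in [h]. If t <= h, the left side is t * t^(B-1).
    Otherwise, for B <= 1 one uses (1 - h/t)^B >= 1 - h/t, and for B > 1 the mean value theorem, the
    derivative being increasing. *)
Lemma pospow_diff_le (t h : R) : 0 < t -> 0 < h ->
  pospow t - pospow (t - h) <= Num.max 1 B * h * t `^ (B - 1).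
Proof.
move=> t0 h0; have tB : t `^ B = t * t `^ (B - 1) by rewrite mulr_powRB1// ltW.
have m1 : 1 <= Num.max 1 B by rewrite le_max lexx.
have p0 : 0 <= t `^ (B - 1) by exact: powR_ge0.
rewrite (pospow_gt0 t0); have [th|ht] := leP t h.
  rewrite pospow_le0 ?subr_le0// subr0 tB ler_wpM2r//.
  by rewrite (le_trans th)// ler_peMl// ltW.
have th0 : 0 < t - h by rewrite subr_gt0.
rewrite pospow_gt0//; have [B1|B1] := leP B 1.
  rewrite mul1r lerBlDr -lerBlDl tB -mulrBl.
  have -> : (t - h) `^ B = t `^ B * (1 - h / t) `^ B.
    rewrite -powRM ?(ltW t0)//; last by rewrite subr_ge0 ler_pdivrMr// mul1r ltW.
    by rewrite mulrBr mulr1 mulrCA divff ?gt_eqF// mulr1.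
  have s0 : 0 < 1 - h / t <= 1.
    rewrite subr_gt0 ltr_pdivrMr// mul1r ht /= lerBlDr lerDl.
    by rewrite divr_ge0 ?ltW.
  have -> : (t - h) * t `^ (B - 1) = t `^ B * (1 - h / t).
    by rewrite tB; field; rewrite gt_eqF.
  by rewrite ler_wpM2l ?powR_ge0// ger1_powR.
have lt_tht : t - h < t by rewrite ltrBlDr ltrDl.
have df s : s \in `](t - h), t[%R ->
    is_derive s 1 (fun s : R => s `^ B) (B * s `^ (B - 1)).
  rewrite in_itv/= => /andP[/(lt_trans th0) s0 _]; exact: is_derive1_powR.
have cf : {within `[t - h, t], continuous (fun s : R => s `^ B)}.
  apply: continuous_in_subspaceT => s; rewrite inE/= in_itv/= => /andP[s1 _].
  exact: (@continuous_powR_comp R B id s (lt_le_trans th0 s1) (@cvg_id _ _)).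
have [c] := MVT lt_tht df cf; rewrite in_itv/= => /andP[c1 c2] ->.
have -> : t - (t - h) = h by ring.
rewrite mulrAC ler_wpM2l //; first by rewrite mulr_ge0 ?ltW.
have c0 := lt_trans th0 c1.
by rewrite ge0_ler_powR ?nnegrE ?subr_ge0 ?(ltW c2) ?(ltW c0) ?(ltW t0) ?(ltW B1).
Qed.
End positive_part_power.

Section truncated_integrals.
Variables (R : realType) (B : R).
Hypothesis B0 : 0 < B.
Notation mu := (@lebesgue_measure R).

Lemma measurable_pospow_sub (D : set R) (b : R) :
  measurable_fun D (fun x => pospow B (x - b)).
Proof.
apply: measurable_funTS; apply: continuous_measurable_fun => x.
apply: (cvg_comp (fun x : R => x - b) (pospow B)); last exact: pospow_continuous.
by apply: cvgB; [exact: cvg_id|exact: cvg_cst].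
Qed.

Lemma integrable_pospow (D : set R) (f : R -> R) (b M : R) :
  measurable D -> mu.-integrable D (EFin \o f) -> (forall x, D x -> x <= M) ->
  mu.-integrable D (EFin \o (fun x => f x * pospow B (x - b))).
Proof.
move=> mD fi DM.
rewrite (_ : (fun x => _) = (fun x => pospow B (x - b) * f x)); last first.
  by apply/funext => x; rewrite mulrC.
apply: (integrable_bddM (M := pospow B (M - b))) => //.
  exact: measurable_pospow_sub.
by move=> x /DM xM; rewrite ger0_norm ?pospow_ge0// ler_pospow// lerD2r.
Qed.

(** Since the truncated power decreases in [b], its value at a - 1 dominates on the whole
    neighbourhood ]a - 1, a + 1[. *)
Lemma truncated_continuous (D : set R) (f : R -> R) (M : R) :
  measurable D -> mu.-integrable D (EFin \o f) -> (forall x, D x -> x <= M) ->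
  continuous (fun b => \int[mu]_(x in D) (f x * pospow B (x - b))).
Proof.
move=> mD fi DM a.
have aI : a \in `](a - 1), (a + 1)[%classic.
  by rewrite inE/= in_itv/=; apply/andP; split; lra.
apply: (@continuity_under_integral R _ _ mu (fun b x => f x * pospow B (x - b)) D
  mD (a - 1) (a + 1) _ _ (fun x => `|f x| * pospow B (x - (a - 1)))) => //.
- by move=> b _; exact: (integrable_pospow b mD fi DM).
- apply: aeW => x Dx b _; apply: cvgM; first exact: cvg_cst.
  apply: (cvg_comp (fun b : R => x - b) (pospow B)); last exact: pospow_continuous.
  by apply: cvgB; [exact: cvg_cst|exact: cvg_id].
- apply: (@integrable_pospow _ _ _ M) => //; exact: (integrable_norm fi).
- move=> b; rewrite /= in_itv/= => /andP[ab _]; apply: aeW => x Dx.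
  rewrite normrM (ger0_norm (pospow_ge0 _ _)) ler_wpM2l// ler_pospow//.
  by rewrite lerD2l lerN2 ltW.
Qed.

(* Only the right derivative has an integrable majorant when [B < 1]: moving [b]
   to the left of [a] would put the singularity of the derivative inside [D]. *)
Lemma truncated_right_derivative (D : set R) (f : R -> R) (a M : R) :
  measurable D -> mu.-integrable D (EFin \o f) ->
  (forall x, D x -> a < x <= M) ->
  mu.-integrable D (EFin \o (fun x => f x * (x - a) `^ (B - 1))) ->
  (\int[mu]_(x in D) (f x * pospow B (x - a))
     - \int[mu]_(x in D) (f x * pospow B (x - b))) / (b - a) @[b --> a^'+]
  --> B * \int[mu]_(x in D) (f x * (x - a) `^ (B - 1)).
Proof.
move=> mD fi Da gi; have DM x : D x -> x <= M by move=> /Da/andP[].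
have pi b := integrable_pospow b mD fi DM.
apply/cvg_at_rightP => u [ua ucvg].
pose q n x := f x * ((pospow B (x - a) - pospow B (x - u n)) / (u n - a)).
have qE n : (\int[mu]_(x in D) (f x * pospow B (x - a))
     - \int[mu]_(x in D) (f x * pospow B (x - u n))) / (u n - a)
     = \int[mu]_(x in D) q n x.
  rewrite -RintegralB// -RintegralZr//.
    by apply: eq_Rintegral => x _; rewrite /q mulrA mulrBr.
  exact: (@integrableB _ _ _ mu D mD _ _ (pi a) (pi (u n))).
under eq_cvg do rewrite qE.
rewrite -RintegralZl//.
have mf : measurable_fun D f by apply/measurable_EFinP; have /integrableP[] := fi.
(* The majorant is [pospow_diff_le] with t = x - a and h = u n - a. *)
have [|||||_ _] := @dominated_convergence _ _ _ mu D mD (fun n x => (q n x)%:E)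
  (fun x => (B * (f x * (x - a) `^ (B - 1)))%:E)
  (fun x => (Num.max 1 B * `|f x * (x - a) `^ (B - 1)|)%:E).
- move=> n; apply/measurable_EFinP; apply: measurable_funM => //.
  apply: measurable_funM => //; apply: measurable_funB; exact: measurable_pospow_sub.
- apply/measurable_EFinP; apply: measurable_funM => //.
  by apply: measurable_funM => //; exact: measurable_powR_sub.
- apply: aeW => x /Da/andP[ax _]; apply: cvg_EFin; first exact: nearW.
  have d1 : is_derive a 1 (fun b : R => x - b) (0 - 1) by exact: is_deriveB.
  have [dG eG] : is_derive a 1 (pospow B \o (fun b : R => x - b))
      (B * (x - a) `^ (B - 1) * (0 - 1)).
    by apply: is_derive1_comp; apply: is_derive_pospow; rewrite subr_gt0.
  have v0 : u n - a @[n --> \oo] --> (0 : R).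
    by rewrite -(subrr a); apply: cvgB => //; exact: cvg_cst.
  have cG := (cvg_at_rightP _ _ _).1 (cvg_dnbhs_at_right dG) (fun n => u n - a).
  rewrite /derive in eG; rewrite eG /= in cG.
  have {}cG := cG (conj (fun n => etrans (subr_gt0 _ _) (ua n)) v0).
  have -> : B * (f x * (x - a) `^ (B - 1))
      = - f x * (B * (x - a) `^ (B - 1) * (0 - 1)) by ring.
  have h : - f x * ((u n - a)^-1 * (pospow B (x - ((u n - a) * 1 + a))
      - pospow B (x - a))) @[n --> \oo]
      --> - f x * (B * (x - a) `^ (B - 1) * (0 - 1)).
    by apply: cvgM cG; exact: cvg_cst.
  apply: cvg_trans h; apply: near_eq_cvg; apply: nearW => n /=.
  by rewrite /q mulr1 subrK; ring.
- rewrite (_ : (fun x => _) = (fun x =>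
      (Num.max 1 B)%:E * (`|f x * (x - a) `^ (B - 1)|)%:E)%E).
    by apply: integrableZl => //; exact: (integrable_norm gi).
  by apply/funext => x; rewrite EFinM.
- apply: aeW => x n /Da/andP[ax _]; rewrite lee_fin /q !normrM [leRHS]mulrCA ler_wpM2l//.
  have un0 : 0 < u n - a by rewrite subr_gt0.
  rewrite normfV (gtr0_norm un0) ler_pdivrMr// ger0_norm; last first.
    by rewrite subr_ge0 ler_pospow// lerD2l lerN2 ltW.
  rewrite (ger0_norm (powR_ge0 _ _)).
  have -> : x - u n = (x - a) - (u n - a) by ring.
  by rewrite mulrAC pospow_diff_le// subr_gt0.
move=> cv; apply: fine_cvg; rewrite fineK//.
apply: (@integrable_fin_num _ _ _ mu D mD).
rewrite (_ : (fun x => _) = (fun x => B%:E * (f x * (x - a) `^ (B - 1))%:E)%E).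
  by apply: integrableZl => //; exact: gi.
by apply/funext => x; rewrite EFinM.
Qed.
End truncated_integrals.

Section functional_limits.
Variables (R : realType) (alpha gamma : R).
Hypothesis halpha : -1 < alpha.
Hypothesis hgamma : -1 < gamma.
Notation mu := (@lebesgue_measure R).
Notation aj_weight := (aj_weight alpha gamma).
Notation aj_left := (aj_left alpha gamma).
Notation aj_right := (aj_right alpha gamma).
Implicit Types (a b B beta x : R) (p : {poly R}).

(** Exponent 0 removes the endpoint from the weight, so [a] is arbitrary and all dependence on [b]
    sits in [pospow]. *)
Lemma aj_weight_pospow beta a b x : 0 < beta -> b < x ->
  aj_weight beta b x = aj_weight 0 a x * pospow beta (x - b).
Proof.
by move=> B0 bx; rewrite /aj_weight powRr0 mulr1 pospow_gt0 ?subr_gt0//; ring.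
Qed.

Lemma aj_left_pospow B u b p : 0 < B -> u <= b -> aj_left B b p =
  \int[mu]_(x in `]u, 0[) (p.[x] * aj_weight 0 u x * pospow B (x - b)).
Proof.
move=> B0 ub; rewrite /aj_left [LHS]Rintegral_mkcond [RHS]Rintegral_mkcond.
apply: eq_Rintegral => x _; rewrite !patchE !mem_setE !in_itv/=.
have [bx|xb] := ltP b x.
  by rewrite (le_lt_trans ub bx)/= (aj_weight_pospow u B0 bx) mulrA.
by rewrite pospow_le0 ?subr_le0// mulr0; case: ifP.
Qed.

Lemma aj_right_pospow B u b p : 0 < B -> b < 0 -> aj_right B b p =
  \int[mu]_(x in `]0, 1[) (p.[x] * aj_weight 0 u x * pospow B (x - b)).
Proof.
move=> B0 b0; apply: eq_Rintegral => x; rewrite inE/= in_itv/= => /andP[x0 _].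
by rewrite (aj_weight_pospow u B0 (lt_trans b0 x0)) mulrA.
Qed.

Let left_integrable u p :
  mu.-integrable `]u, 0[ (EFin \o (fun x => p.[x] * aj_weight 0 u x)).
Proof.
by apply: integrable_poly_weight; apply: aj_weight_integrable_left => //; rewrite ltrN10.
Qed.

Let right_integrable u p : u < 0 ->
  mu.-integrable `]0, 1[ (EFin \o (fun x => p.[x] * aj_weight 0 u x)).
Proof.
by move=> u0; apply: integrable_poly_weight; exact: aj_weight_integrable_right.
Qed.

Lemma aj_left_cvg B a p : 0 < B -> a < 0 ->
  aj_left B b p @[b --> a] --> aj_left B a p.
Proof.
(* The fixed domain has to start to the left of all endpoints close to [a]. *)
move=> B0 a0; rewrite (@aj_left_pospow B (a - 1) a)//; last by rewrite gerBl.
have D0 x : `](a - 1), 0[%classic x -> x <= 0.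
  by rewrite /= in_itv/= => /andP[_ /ltW].
have /(_ a) := truncated_continuous B0 (measurable_itv _)
  (left_integrable (a - 1) p) D0.
apply: cvg_trans; apply: near_eq_cvg; near=> b.
rewrite -aj_left_pospow//; apply: ltW; near: b.
by apply: lt_nbhsr; rewrite gtrBl.
Unshelve. all: by end_near. Qed.

Lemma aj_right_cvg B a p : 0 < B -> a < 0 ->
  aj_right B b p @[b --> a] --> aj_right B a p.
Proof.
move=> B0 a0; rewrite (@aj_right_pospow B a a)//.
have D0 x : `]0, 1[%classic x -> x <= 1.
  by rewrite /= in_itv/= => /andP[_ /ltW].
have /(_ a) := truncated_continuous B0 (measurable_itv _)
  (right_integrable p a0) D0.
apply: cvg_trans; apply: near_eq_cvg; near=> b.
rewrite -aj_right_pospow//; near: b; exact: lt_nbhsl.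
Unshelve. all: by end_near. Qed.

Lemma aj_left_right_derivative beta a p : -1 < beta -> a < 0 ->
  (aj_left (beta + 1) a p - aj_left (beta + 1) b p) / (b - a) @[b --> a^'+]
  --> (beta + 1) * aj_left beta a p.
Proof.
move=> hbeta a0; have B0 : 0 < beta + 1 by lra.
have D0 x : `]a, 0[%classic x -> a < x <= 0.
  by rewrite /= in_itv/= => /andP[-> /ltW].
have wE x : p.[x] * aj_weight 0 a x * (x - a) `^ (beta + 1 - 1)
    = p.[x] * aj_weight beta a x.
  by rewrite addrK /aj_weight powRr0; ring.
have gi : mu.-integrable `]a, 0[ (EFin \o
    (fun x => p.[x] * aj_weight 0 a x * (x - a) `^ (beta + 1 - 1))).
  have h := integrable_poly_weight p (aj_weight_integrable_left alpha hgamma a hbeta).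
  apply: eq_integrable h => //.
  by move=> x _ /=; rewrite wE.
have := truncated_right_derivative B0 (measurable_itv _)
  (left_integrable a p) D0 gi.
have -> : \int[mu]_(x in `]a, 0[)
      (p.[x] * aj_weight 0 a x * (x - a) `^ (beta + 1 - 1))
    = aj_left beta a p by apply: eq_Rintegral => x _; rewrite wE.
apply: cvg_trans; apply: near_eq_cvg; near=> b.
rewrite -!aj_left_pospow//; near: b; exact: nbhs_right_ge.
Unshelve. all: by end_near. Qed.

Lemma aj_right_right_derivative beta a p : -1 < beta -> a < 0 ->
  (aj_right (beta + 1) a p - aj_right (beta + 1) b p) / (b - a) @[b --> a^'+]
  --> (beta + 1) * aj_right beta a p.
Proof.
move=> hbeta a0; have B0 : 0 < beta + 1 by lra.
have D0 x : `]0, 1[%classic x -> a < x <= 1.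
  by rewrite /= in_itv/= => /andP[/(lt_trans a0) -> /ltW].
have wE x : p.[x] * aj_weight 0 a x * (x - a) `^ (beta + 1 - 1)
    = p.[x] * aj_weight beta a x.
  by rewrite addrK /aj_weight powRr0; ring.
have gi : mu.-integrable `]0, 1[ (EFin \o
    (fun x => p.[x] * aj_weight 0 a x * (x - a) `^ (beta + 1 - 1))).
  have h := integrable_poly_weight p (aj_weight_integrable_right halpha hgamma beta a0).
  apply: eq_integrable h => //.
  by move=> x _ /=; rewrite wE.
have := truncated_right_derivative B0 (measurable_itv _)
  (right_integrable p a0) D0 gi.
have -> : \int[mu]_(x in `]0, 1[)
      (p.[x] * aj_weight 0 a x * (x - a) `^ (beta + 1 - 1))
    = aj_right beta a p by apply: eq_Rintegral => x _; rewrite wE.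
apply: cvg_trans; apply: near_eq_cvg; near=> b.
rewrite -!aj_right_pospow//; near: b; exact: nbhs_right_lt.
Unshelve. all: by end_near. Qed.
End functional_limits.

(** * Limits of polynomials from limits of their moments *)

Section determinant_limits.
Variables (R : realType) (T : Type) (F : set_system T).
Context {FF : Filter F}.

Lemma cvg_sumr (I : Type) (r : seq I) (P : pred I) (f : I -> T -> R) (l : I -> R) :
  (forall i, P i -> f i t @[t --> F] --> l i) ->
  \sum_(i <- r | P i) f i t @[t --> F] --> \sum_(i <- r | P i) l i.
Proof. exact: (cvg_big (@add_continuous R)). Qed.

Lemma cvg_prodr (I : Type) (r : seq I) (P : pred I) (f : I -> T -> R) (l : I -> R) :
  (forall i, P i -> f i t @[t --> F] --> l i) ->
  \prod_(i <- r | P i) f i t @[t --> F] --> \prod_(i <- r | P i) l i.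
Proof. exact: (cvg_big (@mul_continuous R)). Qed.

Lemma cvg_det n (M : T -> 'M[R]_n) (A : 'M[R]_n) :
  (forall i j, M t i j @[t --> F] --> A i j) -> \det (M t) @[t --> F] --> \det A.
Proof.
move=> MA; rewrite /determinant; apply: cvg_sumr => s _.
by apply: cvgM; [exact: cvg_cst|apply: cvg_prodr => i _; exact: MA].
Qed.

Lemma cvg_adj n (M : T -> 'M[R]_n) (A : 'M[R]_n) :
  (forall i j, M t i j @[t --> F] --> A i j) ->
  forall i j, (\adj (M t)) i j @[t --> F] --> (\adj A) i j.
Proof.
move=> MA i j; rewrite mxE; under eq_cvg do rewrite mxE.
apply: cvgM; first exact: cvg_cst.
apply: cvg_det => k l; rewrite !mxE; under eq_cvg do rewrite !mxE.
exact: MA.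
Qed.

(* By Cramer's rule the coefficients of [D t] are [adj(M t) / det(M t)] applied
   to its moments, [M t] being the moment matrix. *)
Lemma moment_cvg0 n (L1 L2 : T -> {poly R} -> R) (l1 l2 : {poly R} -> R)
    (D : T -> {poly R}) (x : R) :
  (\forall t \near F, [/\ linear_functional (L1 t), linear_functional (L2 t)
     & (size (D t) <= n.*2)%N]) ->
  (forall p, L1 t p @[t --> F] --> l1 p) ->
  (forall p, L2 t p @[t --> F] --> l2 p) ->
  moment_mx l1 l2 n \in unitmx ->
  (forall i, (i < n.*2)%N -> moment (L1 t) (L2 t) n i (D t) @[t --> F] --> (0 : R)) ->
  (D t).[x] @[t --> F] --> (0 : R).
Proof.
move=> lin c1 c2 Mu mD.
have cm i p : moment (L1 t) (L2 t) n i p @[t --> F] --> moment l1 l2 n i p.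
  by rewrite /moment; case: ifP.
have cM i j : moment_mx (L1 t) (L2 t) n i j @[t --> F] --> moment_mx l1 l2 n i j.
  by rewrite mxE; under eq_cvg do rewrite mxE; exact: cm.
have d0 : \det (moment_mx l1 l2 n) != 0 by rewrite -unitfE -unitmxE.
(* This expression converges by continuity of its ingredients, and it equals the value of [D t] at
   [x] as soon as the determinant is nonzero. *)
pose E t := (\det (moment_mx (L1 t) (L2 t) n))^-1 * \sum_(j < n.*2)
  (\sum_(i < n.*2) moment (L1 t) (L2 t) n i (D t) *
     (\adj (moment_mx (L1 t) (L2 t) n)) i j) * x ^+ j.
have : E t @[t --> F] --> (\det (moment_mx l1 l2 n))^-1 * \sum_(j < n.*2)
  (\sum_(i < n.*2) 0 * (\adj (moment_mx l1 l2 n)) i j) * x ^+ j.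
  apply: cvgM; first by apply: cvgV => //; exact: cvg_det.
  apply: cvg_sumr => j _; apply: cvgM; last exact: cvg_cst.
  by apply: cvg_sumr => i _; apply: cvgM; [exact: mD|exact: cvg_adj].
rewrite [X in _ * X]big1 ?mulr0; last first.
  by move=> j _; rewrite big1 ?mul0r// => i _; rewrite mul0r.
apply: cvg_trans; apply: near_eq_cvg; near=> t.
have [k1 k2 sD] : [/\ linear_functional (L1 t), linear_functional (L2 t)
     & (size (D t) <= n.*2)%N] by near: t.
have dt : \det (moment_mx (L1 t) (L2 t) n) != 0.
  by near: t; apply: cvgr_neq0 d0; exact: cvg_det.
rewrite /E (horner_coef_wide _ sD) mulr_sumr; apply: eq_bigr => j _.
rewrite mulrA; congr (_ * _); apply: (mulfI dt); rewrite mulrA divff// mul1r.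
have := congr1 (fun A : 'rV_n.*2 => A 0 j)
  (mulmxA (poly_rV (D t)) (moment_mx (L1 t) (L2 t) n) (\adj (moment_mx (L1 t) (L2 t) n))).
rewrite mul_mx_adj mul_mx_scalar !mxE => ->.
by apply: eq_bigr => i _; rewrite moment_mxE.
Unshelve. all: by end_near. Qed.
End determinant_limits.

(** * Dependence of the zeros on the endpoint *)

Section separation.
Variable R : realType.
Implicit Types (s : seq R) (x y : R).

Lemma pos_lower_bound (s : seq R) : {in s, forall x, 0 < x} ->
  exists2 d, 0 < d & {in s, forall x, d <= x}.
Proof.
elim: s => [_|x s ih h]; first by exists 1.
have [|d d0 hd] := ih; first by move=> y ys; apply: h; rewrite in_cons ys orbT.
have x0 : 0 < x by apply: h; rewrite mem_head.
exists (Num.min x d); first by rewrite lt_min x0.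
move=> y; rewrite in_cons => /predU1P[->|/hd dy]; first by rewrite ge_min lexx.
by rewrite ge_min dy orbT.
Qed.

Lemma separated s : exists2 d, 0 < d &
  {in s &, forall x y, x != y -> d <= `|x - y|}.
Proof.
have [|d d0 hd] := @pos_lower_bound
    [seq `|z.1 - z.2| | z <- [seq z <- [seq (x, y) | x <- s, y <- s] | z.1 != z.2]].
  move=> z /mapP[[x y] + ->]; rewrite mem_filter /= => /andP[xy _].
  by rewrite normr_gt0 subr_eq0.
exists d => // x y xs ys xy; apply: hd; apply/mapP; exists (x, y) => //.
by rewrite mem_filter /= xy; apply/allpairsP; exists (x, y).
Qed.

(** Each root y other than [x] contributes (x - y)^2 - e^2 > 0, so only the factor at [x] changes
    sign. *)
Lemma rprod_alternate s d x e : uniq s ->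
  {in s &, forall x y, x != y -> d <= `|x - y|} -> x \in s -> 0 < e < d ->
  (rprod s).[x - e] * (rprod s).[x + e] < 0.
Proof.
move=> us sd xs /andP[e0 ed].
rewrite /rprod (big_rem x)//= !hornerM !hornerXsubC !horner_prod mulrACA -big_split/=.
have -> : (x - e - x) * (x + e - x) = - e ^+ 2 by ring.
rewrite mulNr oppr_lt0 mulr_gt0 ?exprn_gt0// big_seq prodr_gt0// => y ys.
rewrite !hornerXsubC.
have yx : x != y by apply: contraTneq ys => <-; rewrite mem_rem_uniqF.
have := sd _ _ xs (mem_rem ys) yx; rewrite -subr_gt0.
have -> : (x - e - y) * (x + e - y) - 0 = `|x - y| ^+ 2 - e ^+ 2.
  by rewrite real_normK ?num_real//; ring.
by move=> dxy; rewrite subr_gt0 ltrXn2r ?nnegrE ?(ltW e0)// (lt_le_trans ed).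
Qed.
End separation.

(** With p, q the polynomials P, Q and c = beta + 1, [D] is the future right derivative of P in the
    endpoint; [l] is the ratio that makes the combination divisible by x - a. *)
Lemma cancelling_combination (R : realFieldType) (p q : {poly R}) (a c : R) k :
  0 < c -> size p = k.+1 -> size q = k.+1 -> 0 < p.[a] -> 0 < q.[a] ->
  exists l D, [/\ 0 < l, D * ('X - a%:P) = c *: (p - l *: q), (size D <= k)%N
    & forall x, a < x -> root p x -> D.[x] = - (c * l * q.[x] / (x - a))].
Proof.
move=> c0 sp sq pa qa; pose l := p.[a] / q.[a]; exists l.
have /factor_theorem[D DE] : root (c *: (p - l *: q)) a.
  have lq : l * q.[a] = p.[a] by rewrite divfK ?gt_eqF.
  by rewrite rootE hornerZ hornerD hornerN (hornerZ l) lq subrr mulr0.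
exists D; split=> //; first by rewrite divr_gt0.
  have [->|D0] := eqVneq D 0; first by rewrite size_poly0.
  have := congr1 (fun p : {poly R} => size p) DE.
  rewrite size_Mmonic ?monicXsubC// size_XsubC addn2 /= => e.
  rewrite -ltnS -e (leq_trans (size_scale_leq _ _))//.
  rewrite (leq_trans (size_polyD _ _))// geq_max size_polyN sp leqnn /=.
  by rewrite (leq_trans (size_scale_leq _ _))// sq.
move=> x ax px; have := congr1 (fun p : {poly R} => p.[x]) DE.
rewrite /= hornerM hornerXsubC hornerZ hornerD hornerN hornerZ (rootP px) sub0r.
move=> e; apply: (mulIf (x := x - a)); first by rewrite gt_eqF// subr_gt0.
by rewrite -e mulNr divfK ?gt_eqF ?subr_gt0//; ring.
Qed.

Section angelesco_jacobi_zeros.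
Variables (R : realType) (m : nat) (alpha beta gamma : R).
Hypothesis halpha : -1 < alpha.
Hypothesis hbeta : -1 < beta.
Hypothesis hgamma : -1 < gamma.
Notation n := m.+1.
Notation aj_left := (aj_left alpha gamma).
Notation aj_right := (aj_right alpha gamma).
Notation P := (angelesco_jacobi n alpha (beta + 1) gamma).
Notation Q := (angelesco_jacobi n alpha beta gamma).

Lemma angelesco_jacobiP (b a : R) : -1 < b -> a < 0 ->
  angelesco (aj_left b a) (aj_right b a) n (angelesco_jacobi n alpha b gamma a).
Proof.
move=> hb a0; apply/(is_angelesco_jacobiE halpha hgamma _ _ a0 hb).
rewrite /angelesco_jacobi; apply: xgetPex.
have [p hp] := angelesco_exists (posfun_left alpha hgamma a0 hb)
  (posfun_right halpha hgamma b a0) n.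
by exists p; apply/(is_angelesco_jacobiE halpha hgamma _ _ a0 hb).
Qed.

Let hbeta1 : -1 < beta + 1. Proof. by move: hbeta => h; lra. Qed.
Let beta1 : 0 < beta + 1. Proof. by move: hbeta => h; lra. Qed.

Lemma angelesco_jacobi_roots (a : R) : a < 0 ->
  [/\ sorted <%R (rootsR (P a)), size (rootsR (P a)) = n.*2,
     P a = rprod (rootsR (P a)) & {in rootsR (P a), forall x, a < x}].
Proof.
move=> a0; have [pm sp o1 o2] := angelesco_jacobiP hbeta1 a0.
have [s1 [s2 [[z1 z2] i1 i2 us e]]] := orth_factor
  (posfun_left alpha hgamma a0 hbeta1) (posfun_right halpha hgamma (beta + 1) a0)
  o1 o2 pm sp.
have {}e : P a = rprod (s1 ++ s2) by rewrite e /rprod big_cat.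
have [|h1 h2 h3] := rprod_rootsR pm sp.
  by exists (s1 ++ s2); split=> //; rewrite size_cat z1 z2 addnn.
split=> // x; rewrite -(roots_on_rootsR (monic_neq0 pm)) => /andP[_].
rewrite e root_prod_XsubC mem_cat => /orP[/i1|/i2]; rewrite in_itv/=.
  by case/andP.
by case/andP => /(lt_trans a0).
Qed.

Lemma moment_orth (L1 L2 : {poly R} -> R) p i :
  orth L1 n p -> orth L2 n p -> (i < n.*2)%N -> moment L1 L2 n i p = 0.
Proof.
move=> o1 o2 ni; rewrite /moment; case: ltnP => [ilt|ige].
  by rewrite o1// size_polyXn.
by rewrite o2// size_polyXn ltn_subLR// addnn.
Qed.

(** At [a] all factors are negative, and there are 2k of them. *)
Lemma angelesco_left_gt0 (L1 L2 : {poly R} -> R) (a c b : R) k p : a < c ->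
  posfun `]a, c[%R L1 -> posfun `]c, b[%R L2 -> angelesco L1 L2 k p -> 0 < p.[a].
Proof.
move=> ac h1 h2 [pm sp o1 o2].
have [s1 [s2 [[z1 z2] i1 i2 us ->]]] := orth_factor h1 h2 o1 o2 pm sp.
have : 0 < (-1) ^+ size (s1 ++ s2) * (rprod (s1 ++ s2)).[a].
  apply: rprod_lt => y; rewrite mem_cat => /orP[/i1|/i2]; rewrite in_itv/=.
    by case/andP.
  by case/andP => /(lt_trans ac).
by rewrite size_cat z1 z2 addnn -signr_odd odd_double mul1r /rprod big_cat.
Qed.

Lemma moment_cvg (a : R) i p : a < 0 ->
  moment (aj_left (beta + 1) b) (aj_right (beta + 1) b) n i p @[b --> a]
  --> moment (aj_left (beta + 1) a) (aj_right (beta + 1) a) n i p.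
Proof.
move=> a0; rewrite /moment; case: (i < n)%N.
  exact: aj_left_cvg.
exact: aj_right_cvg.
Qed.

Lemma moment_right_derivative (a : R) i p : a < 0 ->
  (moment (aj_left (beta + 1) a) (aj_right (beta + 1) a) n i p
   - moment (aj_left (beta + 1) b) (aj_right (beta + 1) b) n i p) / (b - a) @[b --> a^'+]
  --> (beta + 1) * moment (aj_left beta a) (aj_right beta a) n i p.
Proof.
move=> a0; rewrite /moment; case: (i < n)%N.
  exact: aj_left_right_derivative.
exact: aj_right_right_derivative.
Qed.

Lemma momentS (a : R) i p : a < 0 ->
  moment (aj_left (beta + 1) a) (aj_right (beta + 1) a) n i p
  = moment (aj_left beta a) (aj_right beta a) n i (p * ('X - a%:P)).
Proof.
move=> a0; rewrite /moment; case: (i < n)%N.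
  by rewrite aj_leftS mulrA [_ * p]mulrC.
by rewrite aj_rightS// mulrA [_ * p]mulrC.
Qed.

Let lin_left (b a : R) : -1 < b -> a < 0 -> linear_functional (aj_left b a).
Proof. by move=> hb a0; exact: posfun_lin (posfun_left alpha hgamma a0 hb). Qed.

Let lin_right (b a : R) : a < 0 -> linear_functional (aj_right b a).
Proof. by move=> a0; exact: posfun_lin (posfun_right halpha hgamma b a0). Qed.

Let moment_P (a : R) i : a < 0 -> (i < n.*2)%N ->
  moment (aj_left (beta + 1) a) (aj_right (beta + 1) a) n i (P a) = 0.
Proof.
by move=> a0 ni; have [_ _ o1 o2] := angelesco_jacobiP hbeta1 a0; exact: moment_orth.
Qed.

Let size_PB (a b : R) : a < 0 -> b < 0 -> (size (P b - P a)%R <= n.*2)%N.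
Proof.
move=> a0 b0; have [am sa _ _] := angelesco_jacobiP hbeta1 a0.
by have [bm sb _ _] := angelesco_jacobiP hbeta1 b0; exact: size_monicB.
Qed.

Let mx_unit (a : R) : a < 0 ->
  moment_mx (aj_left (beta + 1) a) (aj_right (beta + 1) a) n \in unitmx.
Proof.
move=> a0; exact: moment_mx_unit (posfun_left alpha hgamma a0 hbeta1)
  (posfun_right halpha hgamma (beta + 1) a0) n.
Qed.

Lemma cvg_to_eq (F : set_system R) (f : R -> R) (l l' : R) :
  l = l' -> f x @[x --> F] --> l -> f x @[x --> F] --> l'.
Proof. by move=> ->. Qed.

(** For the functionals at [b], the moments of P b - P a are minus those of P a, which tend to the
    vanishing moments at [a]. *)
Lemma angelesco_jacobi_cvg (a x : R) : a < 0 -> (P b).[x] @[b --> a] --> (P a).[x].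
Proof.
move=> a0.
suff : (P b - P a).[x] @[b --> a] --> (0 : R).
  move=> h.
  have h2 : (P b - P a).[x] + (P a).[x] @[b --> a] --> 0 + (P a).[x].
    exact: cvgD h (cvg_cst _).
  rewrite add0r in h2; apply: cvg_trans h2; apply: near_eq_cvg; apply: nearW => b /=.
  by rewrite hornerD hornerN subrK.
apply: (@moment_cvg0 _ _ _ _ n (aj_left (beta + 1)) (aj_right (beta + 1))
  (aj_left (beta + 1) a) (aj_right (beta + 1) a)).
- near=> b; have b0 : b < 0 by near: b; exact: lt_nbhsl.
  split; [exact: lin_left|exact: lin_right|exact: size_PB].
- by move=> p; exact: aj_left_cvg.
- by move=> p; exact: aj_right_cvg.
- exact: mx_unit.
move=> i ni.
have m0 : - moment (aj_left (beta + 1) a) (aj_right (beta + 1) a) n i (P a) = 0.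
  by rewrite moment_P// oppr0.
apply: (cvg_to_eq m0).
have h : - moment (aj_left (beta + 1) b) (aj_right (beta + 1) b) n i (P a) @[b --> a]
    --> - moment (aj_left (beta + 1) a) (aj_right (beta + 1) a) n i (P a).
  by apply: cvgN; exact: moment_cvg.
apply: (cvg_trans _ h); apply: near_eq_cvg; near=> b.
have b0 : b < 0 by near: b; exact: lt_nbhsl.
have lm := moment_linear n i (lin_left hbeta1 b0) (lin_right (beta + 1) b0).
have e p q : moment (aj_left (beta + 1) b) (aj_right (beta + 1) b) n i p = 0 ->
    - moment (aj_left (beta + 1) b) (aj_right (beta + 1) b) n i q
    = moment (aj_left (beta + 1) b) (aj_right (beta + 1) b) n i (p - q).
  by move=> p0; rewrite (linear_functionalB _ _ lm) p0 sub0r.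
exact: e (moment_P b0 ni).
Unshelve. all: by end_near. Qed.

(** It suffices that the moments at [b] of (P b - P a) / (b - a) - D tend to 0. As P b has zero
    moments at [b] and P a at [a], the quotient contributes the reversed difference of moments of P
    a, with limit beta + 1 times its moments for exponent [beta]; by the choice of [D] this is the
    limit of the moments of [D]. *)
Lemma angelesco_jacobi_right_derivative (a : R) : a < 0 -> exists2 k : R, 0 < k &
  forall x, a < x -> root (P a) x ->
    (P b).[x] / (b - a) @[b --> a^'+] --> - (k * (Q a).[x] / (x - a)).
Proof.
move=> a0.
have jP := angelesco_jacobiP hbeta1 a0; have jQ := angelesco_jacobiP hbeta a0.
have Pa : 0 < (P a).[a].
  exact: (angelesco_left_gt0 a0 (posfun_left alpha hgamma a0 hbeta1)
    (posfun_right halpha hgamma (beta + 1) a0) jP).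
have Qa : 0 < (Q a).[a].
  exact: (angelesco_left_gt0 a0 (posfun_left alpha hgamma a0 hbeta)
    (posfun_right halpha hgamma beta a0) jQ).
have [_ sP _ _] := jP; have [_ sQ oQ1 oQ2] := jQ.
have [k [D [k0 DE sD Dx]]] := cancelling_combination beta1 sP sQ Pa Qa.
exists ((beta + 1) * k); first by rewrite mulr_gt0.
move=> x ax Px; rewrite -(Dx x ax Px).
suff h : ((b - a)^-1 *: (P b - P a) - D).[x] @[b --> a^'+] --> (0 : R).
  have h2 : ((b - a)^-1 *: (P b - P a) - D).[x] + D.[x] @[b --> a^'+] --> 0 + D.[x].
    exact: cvgD h (cvg_cst _).
  rewrite add0r in h2; apply: cvg_trans h2; apply: near_eq_cvg; apply: nearW => b /=.
  have e p q (v : R) : q.[x] = 0 -> (v^-1 *: (p - q) - D).[x] + D.[x] = p.[x] / v.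
    by move=> q0; rewrite !hornerE q0; ring.
  exact: e (rootP Px).
apply: (@moment_cvg0 _ _ _ _ n (aj_left (beta + 1)) (aj_right (beta + 1))
  (aj_left (beta + 1) a) (aj_right (beta + 1) a)).
- near=> b; have b0 : b < 0 by near: b; exact: nbhs_right_lt.
  split; [exact: lin_left|exact: lin_right|].
  rewrite (leq_trans (size_polyD _ _))// geq_max size_polyN sD andbT.
  by rewrite (leq_trans (size_scale_leq _ _))// size_PB.
- by move=> p; apply: cvg_at_right_filter; exact: aj_left_cvg.
- by move=> p; apply: cvg_at_right_filter; exact: aj_right_cvg.
- exact: mx_unit.
move=> i ni.
have lim0 : (beta + 1) * moment (aj_left beta a) (aj_right beta a) n i (P a)
    - moment (aj_left (beta + 1) a) (aj_right (beta + 1) a) n i D = 0.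
  have lm := moment_linear n i (lin_left hbeta a0) (lin_right beta a0).
  have e p q : moment (aj_left beta a) (aj_right beta a) n i q = 0 ->
      D * ('X - a%:P) = (beta + 1) *: (p - k *: q) ->
      (beta + 1) * moment (aj_left beta a) (aj_right beta a) n i p
      - moment (aj_left (beta + 1) a) (aj_right (beta + 1) a) n i D = 0.
    move=> q0 De; rewrite (momentS i D a0) De (linear_functionalZ _ _ lm).
    by rewrite (linear_functionalB _ _ lm) (linear_functionalZ _ _ lm) q0 mulr0 subr0 subrr.
  exact: e (moment_orth oQ1 oQ2 ni) DE.
have c2 : moment (aj_left (beta + 1) b) (aj_right (beta + 1) b) n i D @[b --> a^'+]
    --> moment (aj_left (beta + 1) a) (aj_right (beta + 1) a) n i D.
  by apply: cvg_at_right_filter; exact: moment_cvg.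
have h : (moment (aj_left (beta + 1) a) (aj_right (beta + 1) a) n i (P a)
     - moment (aj_left (beta + 1) b) (aj_right (beta + 1) b) n i (P a)) / (b - a)
   - moment (aj_left (beta + 1) b) (aj_right (beta + 1) b) n i D @[b --> a^'+]
   --> (beta + 1) * moment (aj_left beta a) (aj_right beta a) n i (P a)
    - moment (aj_left (beta + 1) a) (aj_right (beta + 1) a) n i D.
  by apply: cvgB c2; exact: moment_right_derivative.
apply: (cvg_to_eq lim0); apply: (cvg_trans _ h); apply: near_eq_cvg; near=> b.
have b0 : b < 0 by near: b; exact: nbhs_right_lt.
have lm := moment_linear n i (lin_left hbeta1 b0) (lin_right (beta + 1) b0).
have e p q (u v : R) : moment (aj_left (beta + 1) b) (aj_right (beta + 1) b) n i p = 0 ->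
    u = 0 ->
    (u - moment (aj_left (beta + 1) b) (aj_right (beta + 1) b) n i q) / v
      - moment (aj_left (beta + 1) b) (aj_right (beta + 1) b) n i D
    = moment (aj_left (beta + 1) b) (aj_right (beta + 1) b) n i (v^-1 *: (p - q) - D).
  move=> p0 ->; rewrite (linear_functionalB _ _ lm) (linear_functionalZ _ _ lm).
  by rewrite (linear_functionalB _ _ lm) p0 mulrC.
exact: e (moment_P b0 ni) (moment_P a0 ni).
Unshelve. all: by end_near. Qed.
End angelesco_jacobi_zeros.

(** * From local to global monotonicity of the zeros *)

Section monotonicity.
Variables (R : realType) (m : nat) (alpha beta gamma : R).
Hypothesis halpha : -1 < alpha.
Hypothesis hbeta : -1 < beta.
Hypothesis hgamma : -1 < gamma.
Notation n := m.+1.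
Notation P := (angelesco_jacobi n alpha (beta + 1) gamma).
Notation Q := (angelesco_jacobi n alpha beta gamma).

Let hbeta1 : -1 < beta + 1. Proof. by move: hbeta => h; lra. Qed.

Lemma angelesco_jacobi_interlace (a x : R) : a < 0 -> root (P a) x ->
  0 < (P a)^`().[x] * (Q a).[x].
Proof.
move=> a0; have [Pm sP P1 P2] := angelesco_jacobiP m halpha hgamma hbeta1 a0.
have [Qm sQ Q1 Q2] := angelesco_jacobiP m halpha hgamma hbeta a0.
have P1' : orth (fun f => aj_left alpha gamma beta a (('X - a%:P) * f)) n (P a).
  by move=> r /P1; rewrite aj_leftS.
have P2' : orth (fun f => aj_right alpha gamma beta a (('X - a%:P) * f)) n (P a).
  by move=> r /P2; rewrite aj_rightS.
exact: (root_deriv_gt0 a0 (posfun_left alpha hgamma a0 hbeta)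
  (posfun_right halpha hgamma beta a0) Pm Qm sP sQ P1' P2' Q1 Q2).
Qed.

(** Just to the right of [a], P b at an old zero has the sign opposite to Q a, hence to the
    derivative of P a; [rootsR_lt] then places every new zero to the right of the old one. *)
Lemma zeros_right_gt (a : R) s : a < 0 -> s = rootsR (P a) ->
  \forall b \near a^'+, forall k : 'I_n.*2, s`_k < (rootsR (P b))`_k.
Proof.
move=> a0 sE.
have [ss zs PE rs] := angelesco_jacobi_roots m halpha hbeta hgamma a0.
have [l l0 hl] := angelesco_jacobi_right_derivative m halpha hbeta hgamma a0.
rewrite -sE in ss zs PE rs.
have sgn (k : 'I_n.*2) : \forall b \near a^'+,
    (-1) ^+ (n.*2 - k.+1) * (P b).[s`_k] < 0.
  have ks : (k < size s)%N by rewrite zs.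
  have xs : s`_k \in s by exact: mem_nth.
  have Px : root (P a) s`_k by rewrite PE root_prod_XsubC.
  have ax := rs _ xs.
  have c : (-1) ^+ (n.*2 - k.+1) * ((P b).[s`_k] / (b - a)) @[b --> a^'+] -->
      (-1) ^+ (n.*2 - k.+1) * - (l * (Q a).[s`_k] / (s`_k - a)).
    by apply: cvgM; [exact: cvg_cst|exact: hl].
  have lim_lt0 : (-1) ^+ (n.*2 - k.+1) * - (l * (Q a).[s`_k] / (s`_k - a)) < 0.
    have h1 := angelesco_jacobi_interlace a0 Px.
    have h2 := deriv_rprod_sign ss ks; rewrite -PE zs in h2.
    have h3 : 0 < (-1) ^+ (n.*2 - k.+1) * (Q a).[s`_k].
      have := mulr_gt0 h2 h1; rewrite -mulrA (mulrA _ _ (Q a).[s`_k]) -expr2 mulrCA.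
      rewrite pmulr_rgt0// exprn_even_gt0//; apply: contraTneq h1 => ->.
      by rewrite mul0r ltxx.
    rewrite mulrN oppr_lt0 mulrA mulrCA divr_gt0 ?subr_gt0//.
    by rewrite mulr_gt0.
  near=> b.
  have ba : 0 < b - a by rewrite subr_gt0; near: b; exact: nbhs_right_gt.
  rewrite -(pmulr_llt0 _ (x := (b - a)^-1)) ?invr_gt0// -mulrA.
  by near: b; apply: cvgr_lt c _ lim_lt0.
have sgns : \forall b \near a^'+, forall k : 'I_n.*2,
    (-1) ^+ (n.*2 - k.+1) * (P b).[s`_k] < 0 by apply: filter_forall.
near=> b => k.
have b0 : b < 0 by near: b; exact: nbhs_right_lt.
have [Pm sP _ _] := angelesco_jacobiP m halpha hgamma hbeta1 b0.
apply: rootsR_lt => //; rewrite ?zs// => i ilt.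
by have := near sgns b _ (Ordinal ilt); apply.
Unshelve. all: by end_near. Qed.

(** Convergence of P b at the finitely many points at distance [h] from the zeros carries all sign
    changes of P a over to P b. *)
Lemma zeros_cvg (a : R) s (k : nat) : a < 0 -> s = rootsR (P a) -> (k < n.*2)%N ->
  (rootsR (P b))`_k @[b --> a] --> s`_k.
Proof.
move=> a0 sE kn.
have [ss zs PE rs] := angelesco_jacobi_roots m halpha hbeta hgamma a0.
rewrite -sE in ss zs PE rs.
have us : uniq s by apply: sorted_uniq ss; [exact: lt_trans|exact: ltxx].
have [d d0 sd] := separated s.
apply/cvgrPdist_lt => e e0.
(* Half the minimum gives h < e and makes the intervals of radius [h] around the zeros disjoint. *)
pose h := Num.min e d / 2.
have h0 : 0 < h by rewrite divr_gt0// lt_min e0.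
have he : h < e.
  by rewrite /h; have : Num.min e d <= e by [rewrite ge_min lexx]; lra.
have hd : h + h <= d.
  by rewrite /h -splitr ge_min lexx orbT.
have hd1 : h < d by lra.
have sgn (i : 'I_n.*2) : \forall b \near a, (P b).[s`_i - h] * (P b).[s`_i + h] < 0.
  have si : s`_i \in s by rewrite mem_nth// zs.
  have := rprod_alternate us sd si (e := h); rewrite h0 hd1 -PE => /(_ isT) neg.
  have c : (P b).[s`_i - h] * (P b).[s`_i + h] @[b --> a]
      --> (P a).[s`_i - h] * (P a).[s`_i + h].
    by apply: cvgM; exact: angelesco_jacobi_cvg.
  exact: cvgr_lt c _ neg.
have sgns : \forall b \near a, forall i : 'I_n.*2,
    (P b).[s`_i - h] * (P b).[s`_i + h] < 0.
  exact: (@filter_forall _ _ _ (nbhs a) _ sgn).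
near=> b.
have b0 : b < 0 by near: b; exact: lt_nbhsl.
have [Pm sP _ _] := angelesco_jacobiP m halpha hgamma hbeta1 b0.
have key := @rootsR_between _ (P b) n.*2 (fun i => s`_i - h) (fun i => s`_i + h)
  (monic_neq0 Pm) _ _ _ _ k kn.
have /andP[r1 r2] : s`_k - h < (rootsR (P b))`_k < s`_k + h.
  apply: key; first by rewrite sP.
  - by move=> i _; lra.
  - move=> i ilt.
    have lti : s`_i < s`_i.+1 by apply: (sortedP 0 ss); rewrite zs.
    have : d <= `|s`_i.+1 - s`_i|.
      by apply: sd; rewrite ?mem_nth ?zs ?(ltnW ilt)// gt_eqF.
    by rewrite gtr0_norm ?subr_gt0//; lra.
  - by move=> i ilt; have := near sgns b _ (Ordinal ilt); apply.
by rewrite ltr_norml; apply/andP; split; lra.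
Unshelve. all: by end_near. Qed.

Lemma zeros_increasing (k : nat) (a b : R) : (k < n.*2)%N -> a < b -> b < 0 ->
  (rootsR (P a))`_k < (rootsR (P b))`_k.
Proof.
move=> kn ab b0; pose f t := (rootsR (P t))`_k.
have t0 t : t <= b -> t < 0 by move=> /le_lt_trans; apply.
have cf : {within `[a, b], continuous f}.
  apply: continuous_in_subspaceT => t; rewrite inE/= in_itv/= => /andP[_ /t0 tn].
  exact: (zeros_cvg tn (erefl _) kn).
have [c] := EVT_max (ltW ab) cf; rewrite in_itv/= => /andP[ac cb] cmax.
have incr t : t < b -> exists2 u, t < u <= b & f t < f u.
  move=> tb; have [u [/andP[tu ub] fu]] : exists u, t < u <= b /\ f t < f u.
    have h := zeros_right_gt (t0 _ (ltW tb)) (erefl _).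
    near (t^'+) => u; exists u; split.
      by apply/andP; split; near: u; [exact: nbhs_right_gt|exact: nbhs_right_le].
    by have := near h u _ (Ordinal kn); apply.
  by exists u => //; rewrite tu.
(* A maximum at c < b would be exceeded just to its right. *)
have cE : c = b.
  apply/eqP; rewrite eq_le cb leNgt; apply/negP => /incr[u /andP[cu ub]].
  by apply/negP; rewrite -leNgt; apply: cmax; rewrite in_itv/= ub (le_trans ac (ltW cu)).
have [u /andP[au ub] fau] := incr a ab.
apply: lt_le_trans fau _; rewrite -/(f b) -cE; apply: cmax.
by rewrite in_itv/= ub (ltW au).
Unshelve. all: by end_near. Qed.
End monotonicity.

Theorem theorem2p4 (R : realType) (n : nat) (alpha beta gamma : R)
    (hn : (1 <= n)%N) (halpha : -1 < alpha) (hbeta : -1 < beta)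
    (hgamma : -1 < gamma) (j : nat) (hj : (1 <= j <= n.*2)%N) :
  {in `]-oo, 0[ &,
    {homo (fun a : R => angelesco_jacobi_zero n alpha (beta + 1) gamma a j) :
      a b / a < b}}.
Proof.
case: n hn hj => // m _ /andP[j0 jn] a b _; rewrite in_itv/= => b0 ab.
apply: zeros_increasing => //.
by rewrite prednK.
Qed.
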